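(* Let $(a_n)_{n=1}^\infty$ be an $L^2$-good universal sequence of natural numbers such that $(a_n\theta)_{n=1}^\infty$ is uniformly distributed modulo $1$ for every irrational number $\theta$. Then for any $z\in Z^*$, $$\lim_{n\to\infty}\frac1n\cdot\#\big\{1\le j\le n: c_{a_j}(\alpha)=z\big\}=\frac{1}{|z|^{2m}}$$ for $\mu$-almost every $\alpha\in B(0,1)$.
   Context: Let $p$ be a prime and let $K$ be a finite extension of $\mathbb{Q}_p$ of degree $m$, with ramification index $e$ and residue degree $f$ (so $m=ef$). Let $|\cdot|$ be the unique extension to $K$ of the $p$-adic absolute value with $|p|=p^{-1}$. Let $L\subseteq K$ be the unramified subextension of degree $f$ over $\mathbb{Q}_p$, write $L=\mathbb{Q}_p(\gamma)$ with $\gamma$ a primitive $(p^f-1)$-th root of unity, and fix $\beta\in K$ with $K=L(\beta)$ and $|\beta|=p^{1/e}$. Let $X=\{\sum_{j=0}^{k}a_jp^{-j}: k\in\mathbb{N}\cup\{0\},\ a_j\in\{0,1,\dots,p-1\}\}$, $Z=\{\sum_{i=0}^{e-1}\sum_{j=0}^{f-1}b_{i,j}\gamma^j\beta^i: b_{i,j}\in X\}$ and $Z^*=\{c\in Z:|c|>1\}$. For $b=\sum_{j\ge n_0}a_jp^j\in\mathbb{Q}_p$ with digits $a_j\in\{0,1,\dots,p-1\}$ put $\lfloor b\rfloor_p=\sum_{n_0\le j\le 0}a_jp^j$ (which is $0$ if $|b|<1$). Every $\alpha\in K$ is uniquely $\alpha=\sum_{i=0}^{e-1}\sum_{j=0}^{f-1}b_{i,j}\gamma^j\beta^i$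 with $b_{i,j}\in\mathbb{Q}_p$, and $\lfloor\alpha\rfloor=\sum_{i=0}^{e-1}\sum_{j=0}^{f-1}\lfloor b_{i,j}\rfloor_p\gamma^j\beta^i$. Let $B(0,1)=\{x\in K:|x|<1\}$, and let $\mu$ be the restriction to $B(0,1)$ (with its Borel $\sigma$-algebra) of the Haar measure of the additive group $K$, normalized by $\mu(B(0,1))=1$. The continued fraction map $T:B(0,1)\to B(0,1)$ is $T(\alpha)=\frac1\alpha-\left\lfloor\frac1\alpha\right\rfloor$ for $\alpha\ne 0$ and $T(0)=0$. The $n$-th partial quotient of $\alpha\in B(0,1)$ is $c_n(\alpha)=\lfloor 1/T^{n-1}(\alpha)\rfloor$ for $n\ge 1$, defined when $T^{n-1}(\alpha)\neq 0$ (so all $c_n(\alpha)$ are defined for $\mu$-almost every $\alpha$). A strictly increasing sequence of positive integers $(a_n)_{n\ge1}$ is $L^2$-good universal if for each measure-preserving dynamical system $(X,\mathcal{C},\nu,S)$ on a probability space and each $g\in L^2(X,\mathcal{C},\nu)$ the limit $\lim_{n\to\infty}\frac1n\sum_{j=1}^n g(S^{a_j-1}x)$ exists for $\nu$-almost every $x$. A real sequence $(x_n)_{n\ge1}$ is uniformly distributed modulo $1$ if for each interval $I\subseteq[0,1)$, $\lim_{n\to\infty}\frac1n\#\{1\le j\le n:\{x_j\}\in I\}$ equals the length of $I$, where $\{x_j\}$ is the fractional part. *)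

(* Defs.v *)
(* MathComp / MathComp-Analysis. *)
From HB Require Import structures.
From mathcomp Require Import all_boot all_order all_algebra all_field.
From mathcomp Require Import all_classical all_reals all_analysis.
Import Order.TTheory GRing.Theory Num.Theory.
Import numFieldNormedType.Exports.

Set Implicit Arguments.
Unset Strict Implicit.
Unset Printing Implicit Defensive.

Local Open Scope classical_set_scope.
Local Open Scope ring_scope.

Record nonarch_abs (R : realType) (F : fieldType) (v : F -> R) : Prop := {
  nabs_ge0 : forall x, 0 <= v x ;
  nabs_eq0 : forall x, v x = 0 <-> x = 0 ;
  nabsM : forall x y, v (x * y) = v x * v y ;
  nabsD : forall x y, v (x + y) <= Num.max (v x) (v y)
}.

Definition abs_cvg (R : realType) (F : fieldType) (v : F -> R)
    (u : nat -> F) (l : F) : Prop :=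
  v (u n - l) @[n --> \oo] --> (0 : R).

Definition abs_cauchy (R : realType) (F : fieldType) (v : F -> R)
    (u : nat -> F) : Prop :=
  forall eps : R, 0 < eps -> exists N : nat,
    forall m n : nat, (N <= m)%N -> (N <= n)%N -> v (u m - u n) < eps.

(* The library has no p-adic numbers. The field of p-adic numbers is the
   completion of rat for the p-adic absolute value, which determines the pair
   (Qp, v) up to a unique isometric isomorphism. Characteristic 0 is a
   consequence of padic_nat, so ratr is an embedding. *)
Record padic_field (R : realType) (p : nat) (Qp : fieldType) (v : Qp -> R)
    : Prop := {
  padic_abs : nonarch_abs v ;
  padic_nat : forall n : nat, (0 < n)%N -> v n%:R = p%:R ^- logn p n ;
  padic_dense : forall (x : Qp) (eps : R), 0 < eps ->
    exists q : rat, v (x - ratr q) < eps ;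
  padic_complete : forall u : nat -> Qp, abs_cauchy v u ->
    exists l : Qp, abs_cvg v u l
}.

(* The index of the value group v(Qp^* ) in the value group w(U^* ): the
   elements s i represent the cosets. *)
Definition ramification_index (R : realType) (Qp : fieldType)
    (K : fieldExtType Qp) (v : Qp -> R) (w : K -> R) (U : {subfield K})
    (e : nat) : Prop :=
  exists s : 'I_e -> K,
    (forall i, s i \in U /\ s i != 0) /\
    forall x, x \in U -> x != 0 ->
      exists! i : 'I_e, exists y : Qp, y != 0 /\ w x = w (s i) * v y.

(* The dimension of the residue field {w <= 1} / {w < 1} over the residue field
   {v <= 1} / {v < 1}: the residue classes of the elements u i form a basis. *)
Definition residue_degree (R : realType) (Qp : fieldType)
    (K : fieldExtType Qp) (v : Qp -> R) (w : K -> R) (f : nat) : Prop :=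
  exists u : 'I_f -> K,
    [/\ forall i, w (u i) <= 1,
        forall x, w x <= 1 -> exists c : 'I_f -> Qp,
          (forall i, v (c i) <= 1) /\ w (x - \sum_(i < f) c i *: u i) < 1
      & forall c : 'I_f -> Qp, (forall i, v (c i) <= 1) ->
          w (\sum_(i < f) c i *: u i) < 1 -> forall i, v (c i) < 1].

(* b has the expansion \sum_(j >= - k) a_j p^j, where d i stands for the digit
   a_(i - k). Leading zero digits are allowed, so that every b has such an
   expansion with k >= 0. *)
Definition padic_expansion (R : realType) (p : nat) (Qp : fieldType)
    (v : Qp -> R) (b : Qp) (k : nat) (d : nat -> nat) : Prop :=
  (forall i, (d i < p)%N) /\
  abs_cvg v (fun N => \sum_(i < N) (d i)%:R * p%:R ^ (i%:Z - k%:Z)) b.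

(* The digits of the powers p^j with j > 0 are dropped; the expansion is
   unique up to leading zeros, so the set below is a singleton. *)
Definition padic_floor (R : realType) (p : nat) (Qp : fieldType)
    (v : Qp -> R) (b : Qp) : Qp :=
  xget 0 [set y : Qp | exists (k : nat) (d : nat -> nat),
    padic_expansion p v b k d /\
    y = \sum_(i < k.+1) (d i)%:R * p%:R ^ (i%:Z - k%:Z)].

(* The family gamma^j beta^i (i < e, j < f); mxvec_index i j is the position of
   the pair (i, j). *)
Definition ext_basis (Qp : fieldType) (K : fieldExtType Qp) (e f : nat)
    (gamma beta : K) : (e * f).-tuple K :=
  [tuple mxvec (\matrix_(i < e, j < f) (gamma ^+ j * beta ^+ i)) 0 k
     | k < e * f].

Lemma ext_basisE (Qp : fieldType) (K : fieldExtType Qp) (e f : nat)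
    (gamma beta : K) (i : 'I_e) (j : 'I_f) :
  tnth (ext_basis e f gamma beta) (mxvec_index i j) = gamma ^+ j * beta ^+ i.
Proof. by rewrite tnth_mktuple mxvecE mxE. Qed.

(* coord reads off the coordinates b_(i, j) of alpha as soon as ext_basis is a
   basis of K over Qp. *)
Definition ext_floor (R : realType) (p : nat) (Qp : fieldType)
    (K : fieldExtType Qp) (v : Qp -> R) (e f : nat) (gamma beta : K)
    (alpha : K) : K :=
  \sum_(i < e) \sum_(j < f)
    padic_floor p v
      (coord (ext_basis e f gamma beta) (mxvec_index i j) alpha)
    *: (gamma ^+ j * beta ^+ i).

Definition setX_digits (p : nat) (Qp : fieldType) : set Qp :=
  [set x | exists (k : nat) (d : nat -> nat), (forall j, (d j < p)%N) /\
    x = \sum_(j < k.+1) (d j)%:R / p%:R ^+ j].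

Definition setZ_digits (p : nat) (Qp : fieldType) (K : fieldExtType Qp)
    (e f : nat) (gamma beta : K) : set K :=
  [set z | exists b : 'I_e -> 'I_f -> Qp,
    (forall i j, setX_digits p (b i j)) /\
    z = \sum_(i < e) \sum_(j < f) b i j *: (gamma ^+ j * beta ^+ i)].

Definition setZstar_digits (R : realType) (p : nat) (Qp : fieldType)
    (K : fieldExtType Qp) (w : K -> R) (e f : nat) (gamma beta : K) : set K :=
  [set z | setZ_digits p e f gamma beta z /\ 1 < w z].

Definition cf_map (R : realType) (p : nat) (Qp : fieldType)
    (K : fieldExtType Qp) (v : Qp -> R) (e f : nat) (gamma beta : K)
    (alpha : K) : K :=
  if alpha == 0 then 0
  else alpha^-1 - ext_floor p v e f gamma beta alpha^-1.

(* None when the n-th partial quotient (n >= 1) is not defined. *)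
Definition partial_quotient (R : realType) (p : nat) (Qp : fieldType)
    (K : fieldExtType Qp) (v : Qp -> R) (e f : nat) (gamma beta : K)
    (n : nat) (alpha : K) : option K :=
  let t := iter n.-1 (cf_map p v e f gamma beta) alpha in
  if t == 0 then None else Some (ext_floor p v e f gamma beta t^-1).

Definition abs_ball (R : realType) (F : fieldType) (w : F -> R)
    (x : F) (r : R) : set F := [set y | w (y - x) < r].

Definition abs_open (R : realType) (F : fieldType) (w : F -> R)
    : set (set F) :=
  [set U | forall x, U x -> exists r : R, 0 < r /\ abs_ball w x r `<=` U].

Definition abs_compact (R : realType) (F : fieldType) (w : F -> R)
    (A : set F) : Prop :=
  forall C : set (set F), C `<=` abs_open w -> A `<=` \bigcup_(U in C) U ->
    exists D : set (set F),
      [/\ finite_set D, D `<=` C & A `<=` \bigcup_(U in D) U].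

(* A copy of F, needed because measurable types must be pointed. *)
Definition pointed_field (F : fieldType) : Type := F.
HB.instance Definition _ (F : fieldType) := Choice.on (pointed_field F).
HB.instance Definition _ (F : fieldType) :=
  isPointed.Build (pointed_field F) (0 : F).

(* F with the Borel sigma-algebra of the topology defined by w. *)
Definition abs_borel (R : realType) (F : fieldType) (w : F -> R) :=
  g_sigma_algebraType (abs_open w : set (set (pointed_field F))).

Record haar_measure (R : realType) (F : fieldType) (w : F -> R)
    (lambda : set (abs_borel w) -> \bar R) : Prop := {
  haar_translation : forall (x : F) (A : set (abs_borel w)), measurable A ->
    lambda [set x + y | y in (A : set F)] = lambda A ;
  haar_compact : forall A : set (abs_borel w),
    abs_compact w A -> (lambda A < +oo)%E ;
  haar_neq0 : lambda setT <> 0%E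
}.

Definition unit_ball (R : realType) (F : fieldType) (w : F -> R)
    : set (abs_borel w) := abs_ball w 0 1.
Arguments unit_ball {R F} w _.

Lemma measurable_unit_ball (R : realType) (F : fieldType) (w : F -> R)
  (hw : nonarch_abs w) : measurable (unit_ball w).
Proof.
apply: sub_sigma_algebra => x; rewrite /unit_ball /abs_ball /= subr0 => x1.
exists 1; split => // y /= yx1; rewrite subr0 -(subrK x y).
by have := nabsD hw (y - x) x; move/le_lt_trans; apply; rewrite gt_max yx1.
Qed.

Definition strictly_increasing_posints (a : nat -> nat) : Prop :=
  (forall n, (1 <= n)%N -> (0 < a n)%N) /\
  (forall m n, (1 <= m)%N -> (m < n)%N -> (a m < a n)%N).

Definition L2_good_universal (R : realType) (a : nat -> nat) : Prop :=
  strictly_increasing_posints a /\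
  forall (d : measure_display) (X : measurableType d) (nu : probability X R)
      (S : X -> X),
    measurable_fun setT S ->
    (forall A : set X, measurable A -> nu (S @^-1` A) = nu A) ->
  forall g : X -> R, g \in Lfun nu 2%:E ->
    {ae nu, forall x, cvgn (fun n : nat =>
       n%:R^-1 * \sum_(1 <= j < n.+1) g (iter (a j - 1) S x) : R)}.

Definition frac_part (R : realType) (x : R) : R := x - (Num.floor x)%:~R.

(* The booleans bl, br say which endpoints belong to the interval. *)
Definition uniformly_distributed_mod1 (R : realType) (x : nat -> R) : Prop :=
  forall (bl br : bool) (l r : R), l <= r ->
    let I := Interval (BSide bl l) (BSide br r) in
    [set` I] `<=` [set` `[0, 1[%R] ->
    n%:R^-1 * (count (fun j => frac_part (x j) \in I) (index_iota 1 n.+1))%:R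
      @[n --> \oo] --> r - l.

(* Main.v *)
(** The partial quotients are independent and identically distributed: the events
    [c_(a_j) = z] are pairwise independent with probability [|z| ^- (2 m)], and
    the strong law of large numbers applies.

    Independence comes from the ultrametric geometry: for [z] in [Z^*], the map
    [x |-> 1 / (z + x)] sends each ball contained in [B(0,1)] to a ball whose
    radius is smaller by the factor [|z| ^- 2], so that it multiplies Haar measure
    by [|z| ^- (2 m)] on countable disjoint unions of balls. The images of
    [B(0,1)] are the sets [c_1 = z]; they cover [B(0,1)] up to [0], and [T]
    therefore preserves the measure.

    The strong law is obtained from the second moment: the mean square deviation
    over the first [k ^ 2] terms is [O(k ^- 2)], hence summable, and averages
    between consecutive squares differ by [O(1 / k)]. *)
Require Import Defs.
From HB Require Import structures.
From mathcomp Require Import all_boot all_order all_algebra all_field.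
From mathcomp Require Import all_classical all_reals all_analysis.
From mathcomp Require Import measurable_realfun.
From mathcomp Require Import zify ring lra.
Import Order.TTheory GRing.Theory Num.Theory.
Import numFieldNormedType.Exports.
Local Open Scope classical_set_scope.
Local Open Scope ring_scope.

Set Implicit Arguments.
Unset Strict Implicit.
Unset Printing Implicit Defensive.

(** * Nonarchimedean absolute values and p-adic digits *)

(** The measure theory rests on a short list of facts: the value group is generated by [w beta]; the
    residue field has finitely many classes with explicit representatives; [x - fl x] has value less
    than 1; and [fl] takes values in a countable set whose distinct points are at distance at least
    1. Deriving them from the definitions of [e] and [f] is the algebraic half, where the obstacle
    is to show that the [gamma ^+ j * beta ^+ i] form a basis of [K]. Two principles settle it: the
    values of the [beta ^+ i] lie in different cosets of the value group of [Qp], so different [i]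
    cannot cancel; and the powers of [gamma] are independent modulo the maximal ideal, by a count of
    residue classes. The constant arises as follows. With q = p^f residue classes, a ball of radius
    [w beta ^- k] has measure q^-k. If |z| = (w beta)^t, shrinking radii by |z|^2 divides measures
    by q^(2t), which is |z|^(2m) because (w beta)^e = p and m = ef. *)

Section NonarchAbs.
Variables (R : realType) (F : fieldType) (v : F -> R) (hv : nonarch_abs v).

Lemma nabs0 : v 0 = 0. Proof. exact/(nabs_eq0 hv). Qed.

Lemma nabs_gt0 x : (0 < v x) = (x != 0).
Proof.
rewrite lt_neqAle (nabs_ge0 hv) andbT eq_sym; congr (~~ _).
by apply/eqP/eqP => /(nabs_eq0 hv).
Qed.

Lemma nabs1 : v 1 = 1.
Proof.
have v1 : v 1 != 0 by rewrite gt_eqF // nabs_gt0 oner_eq0.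
by apply: (mulfI v1); rewrite -(nabsM hv) !mulr1.
Qed.

Lemma nabsX x n : v (x ^+ n) = v x ^+ n.
Proof. by elim: n => [|n IH]; rewrite ?nabs1 // !exprS (nabsM hv) IH. Qed.

Lemma nabsN x : v (- x) = v x.
Proof.
suff v1 : v (-1) = 1 by rewrite -mulN1r (nabsM hv) v1 mul1r.
have /eqP : v (-1) ^+ 2 = 1 by rewrite -nabsX sqrrN expr1n nabs1.
by rewrite sqrp_eq1 ?(nabs_ge0 hv) // => /eqP.
Qed.

Lemma nabs_distC x y : v (x - y) = v (y - x).
Proof. by rewrite -nabsN opprB. Qed.

Lemma nabsV x : v x^-1 = (v x)^-1.
Proof.
have [->|x0] := eqVneq x 0; first by rewrite invr0 nabs0 invr0.
have vx : v x != 0 by rewrite gt_eqF // nabs_gt0.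
by apply: (mulfI vx); rewrite -(nabsM hv) !divff // nabs1.
Qed.

Lemma nabs_exprz x (n : int) : v (x ^ n) = v x ^ n.
Proof. by case: n => n; rewrite ?NegzE -?invr_expz -?exprnP ?nabsV nabsX. Qed.

Lemma nabsD_lt x y r : v x < r -> v y < r -> v (x + y) < r.
Proof. by move=> ? ?; apply: (le_lt_trans (nabsD hv _ _)); rewrite gt_max; apply/andP. Qed.

Lemma nabsD_le x y r : v x <= r -> v y <= r -> v (x + y) <= r.
Proof. by move=> ? ?; apply: (le_trans (nabsD hv _ _)); rewrite ge_max; apply/andP. Qed.

Lemma nabsB_lt x y r : v x < r -> v y < r -> v (x - y) < r.
Proof. by move=> ? ?; apply: nabsD_lt; rewrite ?nabsN. Qed.

Lemma nabsB_le x y r : v x <= r -> v y <= r -> v (x - y) <= r.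
Proof. by move=> ? ?; apply: nabsD_le; rewrite ?nabsN. Qed.

Lemma nabs_dist_lt x y z r : v (x - y) < r -> v (y - z) < r -> v (x - z) < r.
Proof. by move=> xy yz; rewrite -(subrK y x) -addrA; apply: nabsD_lt. Qed.

Lemma nabs_sum_lt I (s : seq I) (P : pred I) (G : I -> F) r :
  0 < r -> (forall i, P i -> v (G i) < r) -> v (\sum_(i <- s | P i) G i) < r.
Proof.
move=> r0 Gr; apply: (big_ind (fun x => v x < r)) => //; first by rewrite nabs0.
by move=> x y; apply: nabsD_lt.
Qed.

Lemma nabs_sum_le I (s : seq I) (P : pred I) (G : I -> F) r :
  0 <= r -> (forall i, P i -> v (G i) <= r) -> v (\sum_(i <- s | P i) G i) <= r.
Proof.
move=> r0 Gr; apply: (big_ind (fun x => v x <= r)) => //; first by rewrite nabs0.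
by move=> x y; apply: nabsD_le.
Qed.

Lemma nabsD_dom x y : v y < v x -> v (x + y) = v x.
Proof.
move=> yx; apply/eqP; rewrite eq_le nabsD_le // ?(ltW yx) //= leNgt.
apply/negP => xyx; have := nabsB_lt xyx yx; rewrite addrK ltxx //.
Qed.

Lemma nabs_near x y : v (x - y) < v x -> v y = v x.
Proof. by move=> xy; rewrite -[y](subrK x) addrC nabsD_dom // nabs_distC. Qed.

(** No cancellation is possible: the term of largest value strictly exceeds every other nonzero
    term, so it alone fixes the value of the sum. *)
Lemma nabs_dominant (I : finType) (G : I -> F) :
    (forall i j, i != j -> G i != 0 -> G j != 0 -> v (G i) != v (G j)) ->
  forall i, v (G i) <= v (\sum_i G i).
Proof.
move=> Gneq i.
have [j _ jmax] := @Order.TotalTheory.arg_maxP _ _ _ i predT (fun i => v (G i)) isT.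
apply: (le_trans (jmax i isT)).
have [Gj0|Gj0] := eqVneq (G j) 0; first by rewrite Gj0 nabs0 (nabs_ge0 hv).
rewrite (bigD1 j) //= nabsD_dom //; apply: nabs_sum_lt; first by rewrite nabs_gt0.
move=> k kj; have [->|Gk0] := eqVneq (G k) 0; first by rewrite nabs0 nabs_gt0.
by rewrite lt_neqAle Gneq //=; apply: jmax.
Qed.

End NonarchAbs.

(** * Digits and integer parts in the p-adic field *)

Section Padic.
Variables (R : realType) (p : nat) (Qp : fieldType) (v : Qp -> R).
Hypotheses (p_prime : prime p) (QpE : padic_field p v).
Let hv := padic_abs QpE.
Local Notation pR := (p%:R : R).

Let p_gt0 : 0 < pR. Proof. by rewrite ltr0n prime_gt0. Qed.
Let p_gt1 : 1 < pR. Proof. by rewrite ltr1n prime_gt1. Qed.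

Lemma padic_abs_nat_dvd n k : (v n%:R <= pR ^- k) = (p ^ k %| n)%N.
Proof.
case: n => [|n]; first by rewrite dvdn0 nabs0 // invr_ge0 exprn_ge0 // ltW.
rewrite (padic_nat QpE) // pfactor_dvdn // lef_pV2 ?posrE ?exprn_gt0 //.
by rewrite ler_eXn2l.
Qed.

Lemma padic_abs_natP n : (v n%:R < 1) = (p %| n)%N.
Proof.
case: n => [|n]; first by rewrite dvdn0 nabs0 // ltr01.
rewrite (padic_nat QpE) // -[p in RHS]expn1 pfactor_dvdn //.
by rewrite invf_lt1 ?exprn_gt0 // -[1](expr0 pR) ltr_eXn2l.
Qed.

Lemma padic_abs_nat_le1 n : v n%:R <= 1.
Proof. by have := padic_abs_nat_dvd n 0; rewrite expr0 invr1 expn0 dvd1n. Qed.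

Lemma padic_abs_intE (z : int) : v z%:~R = v `|z|%N%:R.
Proof. by case: z => n //; rewrite NegzE mulrNz nabsN. Qed.

Lemma padic_nat_neq0 n : (0 < n)%N -> n%:R != 0 :> Qp.
Proof.
by move=> n0; rewrite -(nabs_gt0 hv) (padic_nat QpE) // invr_gt0 exprn_gt0.
Qed.

Lemma padic_abs_p : v p%:R = pR^-1.
Proof. by rewrite (padic_nat QpE) ?prime_gt0 // logn_prime // eqxx expr1. Qed.

(** By density some rational lies closer to [x] than [v x], hence has the same value, and the value
    of a rational is a power of p. *)
Lemma padic_abs_value x : x != 0 -> exists k : int, v x = pR ^ k.
Proof.
move=> x0; have vx : 0 < v x by rewrite nabs_gt0.
have [q vq] := padic_dense QpE x vx; have vE := nabs_near hv vq.
have vq0 : ratr q != 0 :> Qp by rewrite -(nabs_gt0 hv) vE.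
have nq : (0 < `|numq q|)%N.
  rewrite absz_gt0 numq_eq0; apply: contraNneq vq0 => ->.
  by rewrite /ratr mul0r.
exists ((logn p `|denq q|)%:Z - (logn p `|numq q|)%:Z).
rewrite -vE /ratr (nabsM hv) (nabsV hv) !padic_abs_intE !(padic_nat QpE) //; last first.
  by rewrite absz_gt0 denq_eq0.
by rewrite invrK expfzDr ?gt_eqF // -exprnP -invr_expz -exprnP mulrC.
Qed.

Lemma padic_abs_lt1 x : v x < 1 -> v x <= pR^-1.
Proof.
have [->|x0] := eqVneq x 0; first by rewrite nabs0 // invr_ge0 ltW.
have [k ->] := padic_abs_value x0.
rewrite -[1](expr0z pR) ltr_eXz2l // -exprN1 ler_eXz2l //.
Qed.

(** Replace [x] by a nearby rational of value at most 1. Its denominator is prime to p, since it is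
    coprime to the numerator; inverting it modulo p by Bezout gives the digit. *)
Lemma padic_residue x : v x <= 1 -> exists2 d : nat, (d < p)%N & v (x - d%:R) < 1.
Proof.
move=> x1; have [q xq] := padic_dense QpE x (@ltr01 R).
have q1 : v (ratr q) <= 1.
  rewrite -[ratr q](subrK x) nabsD_le // nabs_distC //; exact: ltW.
have den0 : (denq q)%:~R != 0 :> Qp.
  by rewrite -(nabs_gt0 hv) padic_abs_intE nabs_gt0 // padic_nat_neq0 // absz_gt0 denq_eq0.
have qE : ratr q * (denq q)%:~R = (numq q)%:~R :> Qp by rewrite /ratr divfK.
have cop : coprime `|denq q| p.
  rewrite coprime_sym prime_coprime //; apply/negP => pd.
  have := coprime_num_den q; rewrite /coprime => /eqP cop.
  have : (p %| gcdn `|numq q| `|denq q|)%N.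
    rewrite dvdn_gcd pd andbT -padic_abs_natP -padic_abs_intE -qE (nabsM hv).
    move: pd; rewrite -padic_abs_natP -padic_abs_intE; apply: le_lt_trans.
    by rewrite ler_piMl // (nabs_ge0 hv).
  by rewrite cop dvdn1 => /eqP p1; move: p_prime; rewrite p1.
have [u [t ut]] : exists u t : int, u * denq q + t * p%:Z = 1.
  have [u [t]] := Bezoutz (denq q) p%:Z.
  rewrite /gcdz absz_nat; by move/eqP: cop => -> ut; exists u, t.
have pz : (p%:Z != 0) by rewrite eqz_nat -lt0n prime_gt0.
pose d := ((numq q * u) %% p)%Z.
have d0 : 0 <= d by rewrite modz_ge0.
exists `|d|%N; first by rewrite -ltz_nat gez0_abs // ltz_pmod // ltz_nat prime_gt0.
apply: (nabs_dist_lt hv xq).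
have -> : `|d|%N%:R = d%:~R :> Qp by rewrite -[d in RHS]gez0_abs.
have den1 : v (denq q)%:~R = 1.
  apply/eqP; rewrite padic_abs_intE eq_le padic_abs_nat_le1 leNgt padic_abs_natP.
  by rewrite -prime_coprime // coprime_sym.
suff : v ((ratr q - d%:~R) * (denq q)%:~R) < 1 by rewrite (nabsM hv) den1 mulr1.
rewrite mulrBl qE -intrM -intrB padic_abs_intE padic_abs_natP.
suff : (p%:Z %| numq q - d * denq q)%Z by [].
have -> : numq q - d * denq q =
    (t * numq q + (numq q * u %/ p)%Z * denq q) * p%:Z.
  have := divz_eq (numq q * u) p; rewrite -/d => dE.
  have -> : d = numq q * u - (numq q * u %/ p)%Z * p by rewrite [X in X - _]dE addrC addKr.
  rewrite -[X in X - _]mulr1 -ut; ring.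
exact: dvdz_mull.
Qed.

Lemma padic_expansion_exists b : exists k d, padic_expansion p v b k d.
Proof.
have [k xk] : exists k : nat, v (b * p%:R ^+ k) <= 1.
  have [->|b0] := eqVneq b 0; first by exists 0; rewrite mul0r nabs0.
  have [k bk] := padic_abs_value b0; exists `|k|%N.
  rewrite (nabsM hv) (nabsX hv) padic_abs_p bk exprVn exprnP invr_expz -expfzDr ?gt_eqF //.
  by rewrite -(expr0z pR) ler_eXz2l // subr_le0 abszE ler_norm.
pose x0 := b * p%:R ^+ k.
have pQ0 : p%:R != 0 :> Qp by rewrite padic_nat_neq0 ?prime_gt0.
have /choice [D DP] : forall x : Qp, exists d : nat,
    v x <= 1 -> (d < p)%N /\ v (x - d%:R) < 1.
  move=> x; have [/padic_residue[d dp xd]|_] := boolP (v x <= 1).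
    by exists d.
  by exists 0.
(* [X n] is the remainder after n digits. It stays integral because a value below 1 is at most 1/p,
   which compensates the division by p. *)
pose X := fun n => iter n (fun x => (x - (D x)%:R) / p%:R) x0.
have X1 n : v (X n) <= 1.
  elim: n => // n /DP[_ /padic_abs_lt1]; rewrite /X iterS -/(X n) (nabsM hv) (nabsV hv).
  by rewrite padic_abs_p invrK -ler_pdivlMr // mul1r.
have XE n : x0 = \sum_(i < n) (D (X i))%:R * p%:R ^+ i + p%:R ^+ n * X n.
  elim: n => [|n IH]; first by rewrite big_ord0 add0r mul1r.
  have XS : X n.+1 = (X n - (D (X n))%:R) / p%:R by [].
  rewrite XS {1}IH big_ord_recr /= -addrA; congr (_ + _).
  by rewrite -/(X n) exprS; field.
exists k, (D \o X); split => [i|].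
  by have [] := DP _ (X1 i).
have bE n : v (\sum_(i < n) (D (X i))%:R * p%:R ^ (i%:Z - k%:Z) - b) <= pR ^+ k * pR^-1 ^+ n.
  have -> : b = x0 * p%:R ^- k by rewrite mulfK // expf_neq0.
  rewrite (XE n) mulrDl mulr_suml nabs_distC //.
  under [X in v (_ - X)]eq_bigr do rewrite expfzDr // mulrA -invr_expz -exprnP.
  rewrite addrAC subrr add0r.
  rewrite !(nabsM hv) (nabsV hv) !(nabsX hv) padic_abs_p -exprVn invrK mulrC.
  by rewrite ler_pM2l ?exprn_gt0 // ler_piMr // exprn_ge0 // invr_ge0 ltW.
have gb : (fun n => pR ^+ k * pR^-1 ^+ n) @ \oo --> (0 : R).
  rewrite -[X in _ --> X](mulr0 (pR ^+ k)); apply: cvgMl_tmp.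
  by apply: cvg_expr; rewrite ger0_norm ?invr_ge0 ?(ltW p_gt0) // invf_lt1.
rewrite /abs_cvg; apply: (squeeze_cvgr _ (cvg_cst 0) gb).
by near=> n; rewrite (nabs_ge0 hv) bE.
Unshelve. all: by end_near. Qed.

Lemma setX_digitsE (x : Qp) : setX_digits p x ->
  exists k n, (n < p ^ k.+1)%N /\ x = n%:R / p%:R ^+ k.
Proof.
have pQ0 : p%:R != 0 :> Qp by rewrite padic_nat_neq0 ?prime_gt0.
move=> [k [d [dp ->]]]; exists k, (\sum_(j < k.+1) d j * p ^ (k - j))%N; split; last first.
  rewrite natr_sum mulr_suml; apply: eq_bigr => j _.
  have jk : (j <= k)%N by rewrite -ltnS.
  have -> : p%:R ^+ k = p%:R ^+ j * p%:R ^+ (k - j) :> Qp by rewrite -exprD subnKC.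
  by rewrite natrM natrX invfM mulrACA divff ?mulr1 // expf_neq0.
elim: k => [|k IH]; first by rewrite big_ord1 subnn muln1 expn1.
rewrite big_ord_recr /= subnn muln1.
have -> : (\sum_(i < k.+1) d i * p ^ (k.+1 - i) = (\sum_(i < k.+1) d i * p ^ (k - i)) * p)%N.
  rewrite big_distrl; apply: eq_bigr => i _ /=.
  by rewrite subSn -1?ltnS // expnSr mulnA.
rewrite [X in (_ < X)%N]expnSr.
move: (\sum_(i < k.+1) _)%N IH (dp k.+1) => S IH dk.
apply: (@leq_trans (S.+1 * p)); first by rewrite mulSn addnC ltn_add2r.
by rewrite leq_mul2r IH orbT.
Qed.

(** Over a common denominator p^l both numerators are below p^(l+1). A distance below 1 is at most
    1/p, so the numerators are congruent modulo p^(l+1), hence equal. *)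
Lemma setX_digits_sep (x y : Qp) : setX_digits p x -> setX_digits p y ->
  v (x - y) < 1 -> x = y.
Proof.
have pQ0 : p%:R != 0 :> Qp by rewrite padic_nat_neq0 ?prime_gt0.
suff wl k l n m : (k <= l)%N -> (n < p ^ k.+1)%N -> (m < p ^ l.+1)%N ->
    v (n%:R / p%:R ^+ k - m%:R / p%:R ^+ l) < 1 ->
    n%:R / p%:R ^+ k = m%:R / p%:R ^+ l :> Qp.
  move=> /setX_digitsE[k [n [nk ->]]] /setX_digitsE[l [m [ml ->]]] vxy.
  have [kl|/ltnW lk] := leqP k l; first exact: wl.
  by apply/esym/wl => //; rewrite nabs_distC.
move=> kl nk ml.
have -> : n%:R / p%:R ^+ k = (n * p ^ (l - k))%:R / p%:R ^+ l :> Qp.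
  by rewrite natrM natrX -{2}(subnKC kl) exprD invfM mulrACA divff ?expf_neq0 ?mulr1.
have : (n * p ^ (l - k) < p ^ l.+1)%N.
  have -> : l.+1 = (k.+1 + (l - k))%N by rewrite addSn subnKC.
  by rewrite expnD ltn_pmul2r ?expn_gt0 ?prime_gt0.
move: (n * _)%N => {nk} {}n nl; rewrite -mulrBl (nabsM hv) (nabsV hv) (nabsX hv) padic_abs_p.
move=> vnm; suff -> : n = m by [].
have {}vnm : v (n%:R - m%:R) <= pR ^- l.+1.
  have {}vnm : v ((n%:R - m%:R) / p%:R ^+ l) < 1.
    by rewrite (nabsM hv) (nabsV hv) (nabsX hv) padic_abs_p.
  have /padic_abs_lt1 := vnm; rewrite (nabsM hv) (nabsV hv) (nabsX hv) padic_abs_p.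
  by rewrite exprVn invrK -ler_pdivlMr ?exprn_gt0 // exprS invfM.
wlog le_mn : n m nl ml vnm / (m <= n)%N.
  by move=> wlog; have [?|/ltnW ?] := leqP m n; [|apply/esym];
    apply: wlog => //; rewrite nabs_distC.
move: vnm; rewrite -natrB // padic_abs_nat_dvd => /dvdn_leq nm.
apply/eqP; rewrite eqn_leq le_mn andbT -subn_eq0; apply: contraTT nl.
rewrite -lt0n => /nm pn; rewrite -leqNgt; exact: leq_trans pn (leq_subr _ _).
Qed.

(** The dropped tail consists of integer multiples of positive powers of p. This covers every
    expansion, hence the one picked by [xget]; the existence of an expansion excludes the default
    value. *)
Lemma padic_floorP b :
  setX_digits p (padic_floor p v b) /\ v (b - padic_floor p v b) < 1.
Proof.
have pQ0 : p%:R != 0 :> Qp by rewrite padic_nat_neq0 ?prime_gt0.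
have floorP k d : padic_expansion p v b k d ->
    let y := \sum_(i < k.+1) (d i)%:R * p%:R ^ (i%:Z - k%:Z) in
    setX_digits p y /\ v (b - y) < 1.
  move=> [dp bd] y; split.
    (* [setX_digits] numbers digits downwards from p^0, expansions upwards from p^-k. *)
    exists k, (fun j => d (k - j)%N); split => //.
    rewrite /y (reindex_inj rev_ord_inj); apply: eq_bigr => i _ /=.
    rewrite subSS; have ik : (i <= k)%N by rewrite -ltnS.
    by rewrite -subzn // addrAC subrr add0r -invr_expz -exprnP.
  have [N _ /(_ (N + k.+1)%N)] : \forall n \near \oo,
      v (\sum_(i < n) (d i)%:R * p%:R ^ (i%:Z - k%:Z) - b) < 1.
    have /cvgrPdist_lt/(_ _ ltr01) := bd; apply: filterS => n.
    by rewrite sub0r normrN ger0_norm ?(nabs_ge0 hv).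
  move=> /(_ (leq_addr _ _)); rewrite nabs_distC // => bN.
  apply: (nabs_dist_lt hv bN); rewrite addnC big_split_ord /= addrC addrK.
  apply: nabs_sum_lt => // i _; rewrite (nabsM hv) (nabs_exprz hv) padic_abs_p.
  apply: (@le_lt_trans _ _ (pR^-1 ^ (k.+1 + i - k)%N)).
    have -> : (k.+1 + i)%:Z - k%:Z = (k.+1 + i - k)%N.
      by rewrite subzn // addSn ltnW // ltnS leq_addr.
    by rewrite ler_piMl ?padic_abs_nat_le1 // exprz_ge0 // invr_ge0 ltW.
  by rewrite addSnnS addKn -exprnP exprn_ilt1 ?invr_ge0 ?ltW // invf_lt1.
have [k [d bkd]] := padic_expansion_exists b.
rewrite /padic_floor; case: xgetP => [y _ [k' [d' [bd' ->]]]|/(_ _)]; first exact: floorP.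
by move/(_ (\sum_(i < k.+1) (d i)%:R * p%:R ^ (i%:Z - k%:Z))) => []; exists k, d.
Qed.

End Padic.

(** * The basis of the extension and the integer part *)

Lemma ltn_modz_inj (e i j : nat) (a b : int) : (i < e)%N -> (j < e)%N ->
  i%:Z + e%:Z * a = j%:Z + e%:Z * b -> i = j.
Proof.
move=> ie je /(congr1 (modz^~ e%:Z)).
rewrite ![e%:Z * _]mulrC ![_ + _ * e%:Z]addrC !modzMDl.
by rewrite !modz_small ?ltz_nat // => -[].
Qed.

Section Extension.
Variables (R : realType) (p e f : nat) (Qp : fieldType) (K : fieldExtType Qp).
Variables (v : Qp -> R) (w : K -> R) (gamma beta : K).
Hypotheses (p_prime : prime p) (QpE : padic_field p v).
Hypotheses (hw : nonarch_abs w) (w_ext : forall x : Qp, w x%:A = v x).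
Hypothesis eE : ramification_index v w {:K}%AS e.
Hypothesis fE : residue_degree v w f.
Hypothesis gamma_root : (p ^ f - 1)%N.-primitive_root gamma.
Hypothesis w_beta : w beta = p%:R `^ (e%:R^-1).
Let hv := padic_abs QpE.
Local Notation pi := (w beta).
Local Notation pR := (p%:R : R).

Let p_gt0 : 0 < pR. Proof. by rewrite ltr0n prime_gt0. Qed.
Let p_gt1 : 1 < pR. Proof. by rewrite ltr1n prime_gt1. Qed.

Lemma ext_absZ c x : w (c *: x) = v c * w x.
Proof. by rewrite -mulr_algl (nabsM hw) w_ext. Qed.

Lemma ext_abs_nat n : w n%:R = v n%:R.
Proof. by rewrite -w_ext scaler_nat. Qed.

Lemma ramification_gt0 : (0 < e)%N.
Proof.
case: eE => s [_ /(_ 1 (memvf _) (oner_neq0 _)) [i _]].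
exact: leq_ltn_trans (ltn_ord i).
Qed.

Lemma abs_beta_expe : pi ^+ e = pR.
Proof.
have e0 := ramification_gt0.
rewrite w_beta -powR_mulrn ?powR_ge0 // -powRrM mulVf ?powRr1 ?ltW //.
by rewrite pnatr_eq0 -lt0n.
Qed.

Lemma abs_beta_gt1 : 1 < pi.
Proof.
rewrite ltNge; apply/negP => pi1; move: p_gt1; rewrite -abs_beta_expe ltNge.
by rewrite exprn_ile1 // (nabs_ge0 hw).
Qed.

Let pi_gt0 : 0 < pi. Proof. exact: lt_trans ltr01 abs_beta_gt1. Qed.

Let pi_neq1 : pi != 1. Proof. by rewrite gt_eqF // abs_beta_gt1. Qed.

Lemma beta_neq0 : beta != 0.
Proof. by rewrite -(nabs_gt0 hw). Qed.

Lemma exprz_abs_beta (k : int) : pR ^ k = pi ^ (e%:Z * k).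
Proof. by rewrite -abs_beta_expe exprnP exprz_exp. Qed.

(** The value group of [Qp] is generated by pi^e, so the [beta ^+ j] with j < e have values in e
    distinct cosets. There are only e cosets, so these are all of them: the injection [h] is
    onto. *)
Lemma ext_abs_value x : x != 0 -> exists k : int, w x = pi ^ k.
Proof.
case: eE => s [sU sE] x0.
have valE y : y != 0 -> exists k : int, v y = pi ^ (e%:Z * k).
  by move=> /(padic_abs_value p_prime QpE)[k ->]; exists k; rewrite exprz_abs_beta.
have /choice[h hE] : forall j : 'I_e, exists i : 'I_e,
    exists y : Qp, y != 0 /\ w (beta ^+ j) = w (s i) * v y.
  move=> j; have [|i [? _]] := sE (beta ^+ j) (memvf _); last by exists i.
  by rewrite expf_neq0 // beta_neq0.
have hI : injective h.
  move=> j j' hjj'; have [y [y0 jy]] := hE j; have [y' [y'0]] := hE j'.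
  rewrite -hjj' => jy'; have [k yk] := valE _ y0; have [k' yk'] := valE _ y'0.
  have : pi ^ (j%:Z + e%:Z * k') = pi ^ (j'%:Z + e%:Z * k).
    rewrite !expfzDr ?gt_eqF // -yk -yk' -!exprnP -!(nabsX hw) jy jy'.
    by rewrite -!mulrA [v y * _]mulrC.
  move=> /(ieexprIz pi_gt0 pi_neq1).
  by move=> jk; apply/val_inj; apply: (ltn_modz_inj _ _ jk).
have [i [[y [y0 xE]] _]] := sE x (memvf _) x0.
have /codomP[j ij] := injF_onto hI i.
have [y' [y'0 jE]] := hE j; rewrite -ij in jE.
have [k yk] := valE _ y0; have [k' yk'] := valE _ y'0.
exists (j%:Z + e%:Z * k - e%:Z * k').
have v0 : v y' != 0 by rewrite gt_eqF // (nabs_gt0 hv).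
apply: (mulIf v0); rewrite {2}yk' -expfzDr ?gt_eqF // subrK expfzDr ?gt_eqF //.
by rewrite -exprnP -(nabsX hw) jE -yk xE mulrAC.
Qed.

Lemma ext_abs_lt1 x : w x < 1 -> w x <= pi^-1.
Proof.
have [->|x0] := eqVneq x 0; first by rewrite (nabs0 hw) // invr_ge0 ltW.
have [k ->] := ext_abs_value x0.
by rewrite -[1](expr0z pi) ltr_eXz2l ?abs_beta_gt1 // -exprN1 ler_eXz2l ?abs_beta_gt1.
Qed.

(** * Powers of [gamma] modulo the maximal ideal *)

Lemma residue_order_gt0 : (0 < p ^ f - 1)%N.
Proof. exact: prim_order_gt0 gamma_root. Qed.

Lemma abs_gamma : w gamma = 1.
Proof.
have : w gamma ^+ (p ^ f - 1) = 1.
  by rewrite -(nabsX hw) (prim_expr_order gamma_root) (nabs1 hw).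
by move=> /eqP; rewrite pexpr_eq1 ?residue_order_gt0 ?(nabs_ge0 hw) // => /eqP.
Qed.

Lemma abs_gammaX n : w (gamma ^+ n) = 1.
Proof. by rewrite (nabsX hw) abs_gamma expr1n. Qed.

Lemma abs_residue_order : v (p ^ f - 1)%:R = 1.
Proof.
have f0 : (0 < f)%N by case: f residue_order_gt0.
apply/eqP; rewrite eq_le (padic_abs_nat_le1 p_prime QpE) leNgt (padic_abs_natP p_prime QpE).
apply/negP => pd; have : (p %| 1)%N.
  rewrite -(dvdn_addr _ pd) subnK ?dvdn_exp // expn_gt0 prime_gt0 //.
by rewrite dvdn1 => /eqP p1; move: p_prime; rewrite p1.
Qed.

(* If zeta = gamma ^+ n is congruent to 1 but not equal to 1, then the vanishing
   sum of the first p ^ f - 1 powers of zeta is congruent to the unit p ^ f - 1. *)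
Lemma gammaX_congr1 n : w (gamma ^+ n - 1) < 1 -> gamma ^+ n = 1.
Proof.
set z := gamma ^+ n => z1; apply/eqP; rewrite -subr_eq0; apply/negP => /negP zn1.
have zX k : w (z ^+ k - 1) < 1.
  rewrite subrX1 (nabsM hw); apply: le_lt_trans z1; rewrite ler_piMr ?(nabs_ge0 hw) //.
  by apply: (nabs_sum_le hw) => // i _; rewrite -exprM abs_gammaX.
have zN : z ^+ (p ^ f - 1) - 1 = 0.
  by rewrite -exprM mulnC exprM (prim_expr_order gamma_root) expr1n subrr.
move: zN; rewrite subrX1 => /eqP; rewrite mulf_eq0 (negPf zn1) /= => /eqP sum0.
have : w (\sum_(i < p ^ f - 1) (z ^+ i - 1)) < 1 by apply: (nabs_sum_lt hw).
rewrite sumrB sum0 sub0r (nabsN hw) sumr_const card_ord ext_abs_nat.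
by rewrite abs_residue_order ltxx.
Qed.

Lemma gammaX_congr i j : (i < p ^ f - 1)%N -> (j < p ^ f - 1)%N ->
  w (gamma ^+ i - gamma ^+ j) < 1 -> i = j.
Proof.
wlog ij : i j / (i <= j)%N.
  move=> wlog i_lt j_lt gij; have [/wlog|/ltnW/wlog] := leqP i j; first exact.
  by move=> /(_ j_lt i_lt) ->//; rewrite (nabs_distC hw).
move=> i_lt j_lt gij.
have /gammaX_congr1 g1 : w (gamma ^+ (j - i) - 1) < 1.
  have <- : w (gamma ^+ i - gamma ^+ j) = w (gamma ^+ (j - i) - 1) by
    rewrite -{1}(subnKC ij) exprD -{1}[gamma ^+ i]mulr1 -mulrBr (nabsM hw) abs_gammaX mul1r (nabs_distC hw).
  exact: gij.
have := eq_prim_root_expr gamma_root i j.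
by rewrite -{1}(subnKC ij) exprD g1 mulr1 eqxx !modn_small // => /esym/eqP.
Qed.

(** The span of the classes of the [g j] in the residue field, expressed by integral lifts so that
    no quotient has to be formed. *)
Definition residue_span d (g : 'I_d -> K) (x : K) : Prop :=
  exists c : 'I_d -> Qp, (forall j, v (c j) <= 1) /\ w (x - \sum_j c j *: g j) < 1.

Section ResidueSpan.
Variables (d : nat) (g : 'I_d -> K).

Lemma residue_span_congr x y : w (x - y) < 1 -> residue_span g y -> residue_span g x.
Proof. by move=> xy [c [c1 yc]]; exists c; split => //; apply: (nabs_dist_lt hw xy). Qed.

Lemma residue_span_gen j : residue_span g (g j).
Proof.
exists (fun i => (i == j)%:R); split => [i|].
  by case: eqP => _; rewrite ?(nabs1 hv) ?(nabs0 hv).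
rewrite (bigD1 j) //= eqxx scale1r big1 ?addr0 ?subrr ?(nabs0 hw) // => i /negPf ->.
by rewrite scale0r.
Qed.

Lemma residue_span0 : residue_span g 0.
Proof.
exists (fun=> 0); split => [j|]; first by rewrite (nabs0 hv).
by rewrite big1 ?subrr ?(nabs0 hw) // => j _; rewrite scale0r.
Qed.

Lemma residue_spanD x y : residue_span g x -> residue_span g y -> residue_span g (x + y).
Proof.
move=> [c [c1 xc]] [c' [c'1 yc']]; exists (fun j => c j + c' j); split => [j|].
  exact: (nabsD_le hv).
under eq_bigr do rewrite scalerDl.
by rewrite big_split /= opprD addrACA; apply: (nabsD_lt hw).
Qed.

Lemma residue_spanZ a x : v a <= 1 -> residue_span g x -> residue_span g (a *: x).
Proof.
move=> a1 [c [c1 xc]]; exists (fun j => a * c j); split => [j|].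
  by rewrite (nabsM hv) mulr_ile1 // (nabs_ge0 hv).
under eq_bigr do rewrite -scalerA.
rewrite -scaler_sumr -scalerBr ext_absZ; apply: le_lt_trans xc.
by rewrite ler_piMl // (nabs_ge0 hw).
Qed.

Lemma residue_span_sum I (s : seq I) (P : pred I) (F : I -> K) :
  (forall i, P i -> residue_span g (F i)) -> residue_span g (\sum_(i <- s | P i) F i).
Proof.
by move=> FP; apply: (big_ind (residue_span g)); [exact: residue_span0|exact: residue_spanD|].
Qed.

Definition digit_comb (D : {ffun 'I_d -> 'I_p}) : K := \sum_j ((D j)%:R : Qp) *: g j.

Hypothesis g1 : forall j, w (g j) <= 1.

Lemma digit_comb_le1 D : w (digit_comb D) <= 1.
Proof.
apply: (nabs_sum_le hw) => // j _; rewrite ext_absZ mulr_ile1 ?(nabs_ge0 hv) ?(nabs_ge0 hw) //.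
exact: (padic_abs_nat_le1 p_prime QpE).
Qed.

Lemma residue_span_digits x : residue_span g x -> exists D, w (x - digit_comb D) < 1.
Proof.
move=> [c [c1 xc]].
have /choice[D DP] : forall j, exists d : 'I_p, v (c j - d%:R) < 1.
  move=> j; have [a ap ca] := padic_residue p_prime QpE (c1 j).
  by exists (Ordinal ap).
exists [ffun j => D j]; apply: (nabs_dist_lt hw xc).
rewrite -sumrB; apply: (nabs_sum_lt hw) => // j _.
rewrite ffunE -scalerBl ext_absZ; apply: le_lt_trans (DP j).
by rewrite ler_piMr // (nabs_ge0 hv).
Qed.

(** A pigeonhole form of the dimension bound: every class in the span is that of one of the p^d
    digit combinations, and incongruent elements need different ones. *)
Lemma card_incongruent (I : finType) (h : I -> K) :
    (forall i, residue_span g (h i)) ->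
    (forall i j, w (h i - h j) < 1 -> i = j) ->
  (#|I| <= p ^ d)%N.
Proof.
move=> hg hI.
have /choice[D DP] : forall i, exists D, w (h i - digit_comb D) < 1.
  by move=> i; apply: residue_span_digits.
have DI : injective D.
  move=> i j Dij; apply: hI; apply: (nabs_dist_lt hw (DP i)).
  by rewrite Dij (nabs_distC hw).
by have := leq_card D DI; rewrite card_ffun !card_ord.
Qed.

End ResidueSpan.

Definition gammas (j : 'I_f) : K := gamma ^+ j.

Lemma card_incongruent_integral (I : finType) (h : I -> K) :
    (forall i, w (h i) <= 1) -> (forall i j, w (h i - h j) < 1 -> i = j) ->
  (#|I| <= p ^ f)%N.
Proof.
case: fE => u [u1 us _] h1; apply: (@card_incongruent f u) => // i.
exact: us.
Qed.

(* A nontrivial relation would express all powers of gamma, modulo the maximal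
   ideal, by the first d < f of them; this leaves at most p ^ d classes for the
   p ^ f pairwise incongruent elements 0, 1, gamma, gamma ^+ 2, ... *)
Lemma gammas_indep (c : 'I_f -> Qp) : (forall j, v (c j) <= 1) ->
  w (\sum_j c j *: gammas j) < 1 -> forall j, v (c j) < 1.
Proof.
move=> c1 cs j; rewrite ltNge; apply/negP => cj1.
(* [d] is the last index with a unit coefficient: later terms vanish modulo the maximal ideal, and
   dividing by [c d] expresses gamma^d by lower powers. *)
have [d /= cd1 dmax] := @arg_maxnP _ j (fun j => 1 <= v (c j)) (@nat_of_ord f) cj1.
have vcd : v (c d) = 1 by apply/eqP; rewrite eq_le c1.
pose g (i : 'I_d) : K := gamma ^+ i.
have gd : residue_span g (gamma ^+ d).
  exists (fun i => - (c (widen_ord (ltnW (ltn_ord d)) i) / c d)); split => [i|].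
    by rewrite (nabsN hv) (nabsM hv) (nabsV hv) vcd invr1 mulr1.
  have cd0 : c d != 0 by rewrite -(nabs_gt0 hv) vcd.
  have -> : gamma ^+ d - \sum_(i < d) - (c (widen_ord (ltnW (ltn_ord d)) i) / c d) *: g i
     = (c d)^-1 *: \sum_(i < f | (i <= d)%N) c i *: gammas i.
    rewrite (bigD1 d) //= scalerDr scalerA mulVf // scale1r; congr (_ + _).
    rewrite -sumrN scaler_sumr.
    under [RHS]eq_bigl => i do rewrite -val_eqE /= andbC -ltn_neqAle.
    rewrite (big_ord_narrow (ltnW (ltn_ord d))) /=.
    by apply: eq_bigr => i _; rewrite scaleNr opprK scalerA mulrC.
  rewrite ext_absZ (nabsV hv) vcd invr1 mul1r.
  have -> : \sum_(i < f | (i <= d)%N) c i *: gammas i =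
      \sum_i c i *: gammas i - \sum_(i < f | ~~ (i <= d)%N) c i *: gammas i.
    by rewrite [X in _ = X - _](bigID (fun i : 'I_f => (i <= d)%N)) /= addrK.
  apply: (nabsB_lt hw) => //; apply: (nabs_sum_lt hw) => // i; rewrite -ltnNge => di.
  rewrite ext_absZ abs_gammaX mulr1 ltNge; apply: contraL di => /dmax.
  by rewrite -leqNgt.
(* Multiplication by [gamma] raises each exponent by one; if exponent d appears, [gd] brings it back
   into the span. *)
have gn n : residue_span g (gamma ^+ n).
  elim: n => [|n [b [b1 nb]]].
    case: (posnP d) => [d0|d0]; first by rewrite -{1}d0.
    exact: (residue_span_gen g (Ordinal d0)).
  apply: (@residue_span_congr _ _ _ (gamma * \sum_i b i *: g i)).
    by rewrite exprS -mulrBr (nabsM hw) abs_gamma mul1r.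
  rewrite mulr_sumr; apply: residue_span_sum => i _.
  rewrite -scalerAr; apply: residue_spanZ => //; rewrite -exprS.
  have [iSd|] := ltnP i.+1 d; first exact: (residue_span_gen g (Ordinal iSd)).
  by move=> di; have -> : i.+1 = d by apply/eqP; rewrite eqn_leq di ltn_ord.
pose h (i : option 'I_(p ^ f - 1)) : K := if i is Some i then gamma ^+ i else 0.
have : (#|{: option 'I_(p ^ f - 1)}| <= p ^ d)%N.
  apply: (@card_incongruent d g _ _ h).
  - by move=> i; rewrite abs_gammaX.
  - by case=> [i|] /=; [exact: gn | exact: residue_span0].
  - case=> [i|] [k|] //=; rewrite ?subr0 ?sub0r ?(nabsN hw) ?abs_gammaX ?ltxx //.
    by move=> /gammaX_congr ik; congr Some; apply/val_inj/ik.
rewrite card_option card_ord -subSn ?subn1 ?expn_gt0 ?prime_gt0 //=.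
by rewrite leq_exp2l ?prime_gt1 // leqNgt ltn_ord.
Qed.

Lemma digit_comb_inj (D D' : {ffun 'I_f -> 'I_p}) :
  w (digit_comb gammas D - digit_comb gammas D') < 1 -> D = D'.
Proof.
rewrite -sumrB; under eq_bigr do rewrite -scalerBl.
have digX (d : 'I_p) : setX_digits p (d%:R : Qp).
  by exists 0, (fun=> d); split => //; rewrite big_ord1 expr0 divr1.
have natI (a b : 'I_p) : a%:R = b%:R :> Qp -> a = b.
  wlog ab : a b / (a <= b)%N.
    by move=> wl; have [/wl|/ltnW/wl ba] := leqP a b; [exact|move=> /esym/ba].
  move=> eab; apply/val_inj/eqP; rewrite eqn_leq ab /= -subn_eq0 -leqn0 leqNgt.
  apply/negP => /(padic_nat_neq0 p_prime QpE); rewrite natrB // eab subrr.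
  by rewrite eqxx.
move=> /gammas_indep DD; apply/ffunP => j; apply: natI.
apply: (setX_digits_sep p_prime QpE) => //; apply: DD => i.
by apply: (nabsB_le hv); apply: (padic_abs_nat_le1 p_prime QpE).
Qed.

(** The p^f digit combinations are already pairwise incongruent. An integral [x] congruent to none
    of them would be one more, against the bound p^f on residue classes. *)
Lemma digit_comb_onto x : w x <= 1 -> exists D, w (x - digit_comb gammas D) < 1.
Proof.
move=> x1; apply/not_existsP => xD.
pose h (D : option {ffun 'I_f -> 'I_p}) := if D is Some D then digit_comb gammas D else x.
have g1 j : w (gammas j) <= 1 by rewrite abs_gammaX.
have : (#|{: option {ffun 'I_f -> 'I_p}}| <= p ^ f)%N.
  apply: (@card_incongruent_integral _ h).
    by case=> [D|] //=; apply: digit_comb_le1.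
  case=> [D|] [D'|] //=.
  - by move=> /digit_comb_inj ->.
  - by rewrite (nabs_distC hw) => /xD.
  - by move=> /xD.
by rewrite card_option card_ffun !card_ord ltnn.
Qed.

(** Dividing by a coefficient of largest value makes all coefficients integral and one a unit, so
    independence modulo the maximal ideal applies. Naming the maximum [v y] records that it is a
    value taken on [Qp]. *)
Lemma gammas_norm (c : 'I_f -> Qp) : exists2 y,
  w (\sum_j c j *: gammas j) = v y & forall j, v (c j) <= v y.
Proof.
have f0 : (0 < f)%N by case: f residue_order_gt0.
have [j0 _ jmax] :=
  @Order.TotalTheory.arg_maxP _ _ _ (Ordinal f0) predT (fun j => v (c j)) isT.
exists (c j0) => [|j]; last exact: jmax.
have [c0|c0] := eqVneq (c j0) 0.
  rewrite big1 ?c0 ?(nabs0 hw) ?(nabs0 hv) // => j _.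
  have : v (c j) <= 0 by rewrite -(nabs0 hv) -c0; apply: jmax.
  by rewrite leNgt (nabs_gt0 hv) negbK => /eqP ->; rewrite scale0r.
have vc0 : 0 < v (c j0) by rewrite (nabs_gt0 hv).
have c1 j : v (c j / c j0) <= 1.
  by rewrite (nabsM hv) (nabsV hv) ler_pdivrMr // mul1r; apply: jmax.
have -> : \sum_j c j *: gammas j = c j0 *: \sum_j (c j / c j0) *: gammas j.
  by rewrite scaler_sumr; apply: eq_bigr => j _; rewrite scalerA mulrC divfK.
rewrite ext_absZ; apply/eqP; rewrite eq_le ler_piMr ?(nabs_ge0 hv) //=; last first.
  apply: (nabs_sum_le hw) => // j _; by rewrite ext_absZ abs_gammaX mulr1.
rewrite ler_peMr ?(nabs_ge0 hv) // leNgt; apply/negP => /gammas_indep/(_ j0).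
by rewrite divff // (nabs1 hv) ltxx => /(_ c1).
Qed.

(** * The basis formed by the products of powers of [gamma] and [beta] *)

Definition basis_comb (b : 'I_e -> 'I_f -> Qp) : K :=
  \sum_(i < e) \sum_(j < f) b i j *: (gamma ^+ j * beta ^+ i).

Lemma basis_combE (b : 'I_e -> 'I_f -> Qp) :
  basis_comb b = \sum_(i < e) (\sum_(j < f) b i j *: gammas j) * beta ^+ i.
Proof.
apply: eq_bigr => i _; rewrite mulr_suml; apply: eq_bigr => j _.
by rewrite scalerAl.
Qed.

Lemma basis_combB (b b' : 'I_e -> 'I_f -> Qp) : basis_comb b - basis_comb b' = basis_comb (fun i j => b i j - b' i j).
Proof.
rewrite -sumrB; apply: eq_bigr => i _; rewrite -sumrB; apply: eq_bigr => j _.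
by rewrite scalerBl.
Qed.

(** The inner sum for [i], if nonzero, has value in pi^(eZ), so after multiplication by [beta ^+ i]
    its exponent is i modulo e. Nonzero terms thus have distinct values and [nabs_dominant]
    applies. *)
Lemma basis_comb_norm (b : 'I_e -> 'I_f -> Qp) i j : v (b i j) * pi ^+ i <= w (basis_comb b).
Proof.
rewrite basis_combE.
pose G (i : 'I_e) := (\sum_(j < f) b i j *: gammas j) * beta ^+ i.
have /choice[y yP] : forall i : 'I_e, exists y,
    w (\sum_(j < f) b i j *: gammas j) = v y /\ forall j, v (b i j) <= v y.
  by move=> k; have [y ? ?] := gammas_norm (b k); exists y.
have GE k : w (G k) = v (y k) * pi ^+ k.
  by rewrite /G (nabsM hw) (nabsX hw) (yP k).1.
apply: (@le_trans _ _ (w (G i))).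
  by rewrite GE ler_wpM2r ?exprn_ge0 ?(nabs_ge0 hw) // (yP i).2.
apply: (nabs_dominant hw (G := G)) => {i j} i j ij.
rewrite -!(nabs_gt0 hw) !GE => Gi Gj.
have y0 k : 0 < v (y k) * pi ^+ k -> y k != 0.
  by apply: contraTneq => ->; rewrite (nabs0 hv) mul0r ltxx.
have [k ->] := padic_abs_value p_prime QpE (y0 _ Gi).
have [l ->] := padic_abs_value p_prime QpE (y0 _ Gj).
rewrite !exprz_abs_beta !exprnP -!expfzDr ?lt0r_neq0 //; apply/negP => /eqP.
move=> /(ieexprIz pi_gt0 pi_neq1).
rewrite addrC [X in _ = X]addrC => kl; move/negP: ij; apply; apply/eqP/val_inj.
exact: (ltn_modz_inj _ _ kl).
Qed.

Lemma basis_comb_le (b : 'I_e -> 'I_f -> Qp) r : 0 <= r -> (forall i j, v (b i j) * pi ^+ i <= r) ->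
  w (basis_comb b) <= r.
Proof.
move=> r0 br; apply: (nabs_sum_le hw) => // i _; apply: (nabs_sum_le hw) => // j _.
by rewrite ext_absZ (nabsM hw) abs_gammaX mul1r (nabsX hw).
Qed.

(** Some [t], a power of p times a power of [beta], has the same value as [x]. The unit x/t is
    congruent to a digit combination, and discreteness of the values turns an error below 1 into one
    of at most [pi^-1]. *)
Lemma basis_comb_approx x : exists b, w (x - basis_comb b) <= pi^-1 * w x.
Proof.
have [->|x0] := eqVneq x 0.
  exists (fun _ _ => 0); rewrite (nabs0 hw) mulr0 sub0r (nabsN hw).
  by apply: basis_comb_le => // i j; rewrite (nabs0 hv) mul0r.
have [k xk] := ext_abs_value x0; have e0 := ramification_gt0.
have pQ0 : p%:R != 0 :> Qp by apply: (padic_nat_neq0 p_prime QpE); rewrite prime_gt0.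
pose a := (k %/ e)%Z; pose i := `|(k %% e)%Z|%N.
have ie : (i < e)%N by rewrite -ltz_nat gez0_abs ?modz_ge0 ?ltz_pmod // eqz_nat -lt0n.
have kE : k = e%:Z * a + i.
  by rewrite /i gez0_abs ?modz_ge0 ?eqz_nat -?lt0n // mulrC -divz_eq.
pose s := (p%:R : Qp) ^ (- a); have s0 : s != 0 by rewrite expfz_neq0.
have vs : v s = pi ^ (e%:Z * a).
  by rewrite /s (nabs_exprz hv) (padic_abs_p p_prime QpE) exprz_inv opprK exprz_abs_beta.
pose t := s *: beta ^+ i.
have wt : w t = w x by rewrite /t ext_absZ vs (nabsX hw) xk kE expfzDr ?gt_eqF.
have t0 : t != 0 by rewrite -(nabs_gt0 hw) wt (nabs_gt0 hw).
have wx : 0 < w x by rewrite (nabs_gt0 hw).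
have [|D xD] := @digit_comb_onto (x / t).
  by rewrite (nabsM hw) (nabsV hw) wt divff // gt_eqF.
exists (fun i' j => if i' == i :> nat then s * (D j)%:R else 0).
have -> : basis_comb (fun i' j => if i' == i :> nat then s * (D j)%:R else 0) =
    digit_comb gammas D * t.
  rewrite basis_combE (bigD1 (Ordinal ie)) //= eqxx [X in _ + X]big1 ?addr0 => [|i' i'i].
    rewrite /t -scalerAr scalerAl; congr (_ * _); rewrite scaler_sumr.
    by apply: eq_bigr => j _; rewrite scalerA.
  rewrite big1 ?mul0r // => j _.
  by move: i'i; rewrite -val_eqE /= => /negPf ->; rewrite scale0r.
rewrite -{1}[x](divfK t0) -mulrBl (nabsM hw) wt ler_pM2r //.
exact: ext_abs_lt1.
Qed.

(* Successive approximation: the coordinates of the approximants are Cauchy by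
   basis_comb_norm and converge since Qp is complete. *)
Lemma basis_comb_onto x : exists b, x = basis_comb b.
Proof.
have /choice[B BP] := basis_comb_approx.
pose X n := iter n (fun x => x - basis_comb (B x)) x.
have pi1 : pi^-1 < 1 by rewrite invf_lt1 // abs_beta_gt1.
have piV0 : 0 <= pi^-1 by rewrite invr_ge0 ltW.
have XE n : w (X n) <= pi^-1 ^+ n * w x.
  elim: n => [|n IH]; first by rewrite mul1r.
  by apply: (le_trans (BP _)); rewrite exprS -mulrA ler_wpM2l.
pose b n i j := \sum_(k < n) B (X k) i j.
have bE n : basis_comb (b n) = x - X n.
  elim: n => [|n IH].
    rewrite subrr /basis_comb big1 // => i _; rewrite big1 // => j _.
    by rewrite /b big_ord0 scale0r.
  have -> : X n.+1 = X n - basis_comb (B (X n)) by [].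
  rewrite opprB addrCA addrC -IH -[LHS](subrK (basis_comb (b n))) basis_combB addrC.
  congr (_ + _); apply: eq_bigr => i _; apply: eq_bigr => j _.
  by rewrite /b big_ord_recr /= addrAC subrr add0r.
have X0 : (fun n => pi^-1 ^+ n * w x) @ \oo --> (0 : R).
  rewrite -[X in _ --> X](mul0r (w x)); apply: cvgMr_tmp.
  by apply: cvg_expr; rewrite ger0_norm.
have pXge1 i : 1 <= pi ^+ i by rewrite exprn_ege1 // ltW // abs_beta_gt1.
have b_cauchy i j : abs_cauchy v (fun n => b n i j).
  move=> eps eps0.
  have [N _ NP] : \forall n \near \oo, pi^-1 ^+ n * w x < eps.
    have /cvgrPdist_lt/(_ _ eps0) := X0; apply: filterS => n.
    by rewrite sub0r normrN ger0_norm // mulr_ge0 ?exprn_ge0 // (nabs_ge0 hw).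
  exists N => m n Nm Nn; apply: (@le_lt_trans _ _ (w (basis_comb (b m) - basis_comb (b n)))).
    rewrite basis_combB; apply: le_trans (basis_comb_norm _ i j).
    by rewrite ler_peMr // (nabs_ge0 hv).
  have -> : basis_comb (b m) - basis_comb (b n) = X n - X m by rewrite !bE; ring.
  apply: (nabsB_lt hw).
    by apply: (le_lt_trans (XE n)); apply: NP.
  by apply: (le_lt_trans (XE m)); apply: NP.
have /choice[l lP] : forall ij : 'I_e * 'I_f, exists l, abs_cvg v (fun n => b n ij.1 ij.2) l.
  by move=> [i j]; apply: (padic_complete QpE).
exists (fun i j => l (i, j)); apply/eqP; rewrite -subr_eq0; apply/negP => /negP.
rewrite -(nabs_gt0 hw); set y := basis_comb _ => xy.
have [N1 _ N1P] : \forall n \near \oo, pi^-1 ^+ n * w x < w (x - y).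
  have /cvgrPdist_lt/(_ _ xy) := X0; apply: filterS => n.
  by rewrite sub0r normrN ger0_norm // mulr_ge0 ?exprn_ge0 // (nabs_ge0 hw).
(* The factor [pi ^+ e] absorbs the weights [pi ^+ i], and the 2 makes the final comparison strict.
   Both parts of x - y will be smaller than [w (x - y)], which is absurd. *)
have [N2 _ N2P] : \forall n \near \oo, forall ij : 'I_e * 'I_f,
    v (b n ij.1 ij.2 - l ij) < w (x - y) / pi ^+ e / 2.
  apply: filter_forall => ij; have /cvgrPdist_lt := lP ij.
  have eps0 : 0 < w (x - y) / pi ^+ e / 2 by rewrite !divr_gt0 ?exprn_gt0.
  move=> /(_ _ eps0); apply: filterS => n.
  by rewrite sub0r normrN ger0_norm // (nabs_ge0 hv).
pose n := maxn N1 N2.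
suff : w (x - y) < w (x - y) by rewrite ltxx.
rewrite -{1}(subrK (basis_comb (b n)) x) -addrA; apply: (nabsD_lt hw).
  rewrite bE opprB addrC subrK; apply: (le_lt_trans (XE n)); apply: N1P.
  by rewrite /= /n leq_maxl.
rewrite basis_combB; apply: (@le_lt_trans _ _ (w (x - y) / 2)); last first.
  by rewrite ltr_pdivrMr // ltr_pMr // ltr1n.
apply: basis_comb_le => [|i j]; first by rewrite divr_ge0 // ltW.
have /(_ (i, j))/ltW /= bl := N2P n (leq_maxr _ _).
apply: (@le_trans _ _ (w (x - y) / pi ^+ e / 2 * pi ^+ e)).
  apply: ler_pM => //; rewrite ?(nabs_ge0 hv) ?exprn_ge0 ?(nabs_ge0 hw) //.
  by apply: ler_weXn2l; [exact: ltW abs_beta_gt1 | exact: ltnW (ltn_ord i)].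
by rewrite mulrAC divfK // gt_eqF // exprn_gt0.
Qed.

Lemma basis_comb_coord (c : 'I_(e * f) -> Qp) :
  \sum_k c k *: (ext_basis e f gamma beta)`_k = basis_comb (fun i j => c (mxvec_index i j)).
Proof.
rewrite (reindex _ (curry_mxvec_bij _ _)) /= /basis_comb pair_bigA /=.
apply: eq_bigr => -[i j] _ /=.
by rewrite -(ext_basisE gamma beta i j) (tnth_nth 0).
Qed.

Lemma ext_basis_basis : basis_of fullv (ext_basis e f gamma beta).
Proof.
rewrite /basis_of; apply/andP; split; last first.
  apply/freeP => c; rewrite basis_comb_coord => c0 k.
  case/mxvec_indexP: k => i j; apply/eqP; rewrite -[_ == _]negbK -(nabs_gt0 hv) -leNgt.
  have := basis_comb_norm (fun i j => c (mxvec_index i j)) i j.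
  by rewrite c0 (nabs0 hw) pmulr_lle0 // exprn_gt0.
rewrite eqEsubv subvf /=; apply/subvP => x _; have [b ->] := basis_comb_onto x.
apply: rpred_sum => i _; apply: rpred_sum => j _; apply: rpredZ; apply: memv_span.
by rewrite -(ext_basisE gamma beta i j) mem_tnth.
Qed.

Lemma ext_dim : \dim {:K} = (e * f)%N.
Proof. exact: size_basis ext_basis_basis. Qed.

Lemma basis_combK x :
  x = basis_comb (fun i j => coord (ext_basis e f gamma beta) (mxvec_index i j) x).
Proof.
by rewrite {1}(coord_basis ext_basis_basis (memvf x)) basis_comb_coord.
Qed.

(** * The integer part on the extension *)

Local Notation floor := (ext_floor p v e f gamma beta).
Local Notation Z := (setZ_digits p e f gamma beta).

Lemma ext_floor_in x : Z (floor x).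
Proof.
exists (fun i j => padic_floor p v (coord (ext_basis e f gamma beta) (mxvec_index i j) x)).
by split => // i j; have [] := padic_floorP p_prime QpE (coord (ext_basis e f gamma beta) (mxvec_index i j) x).
Qed.

(** Each coordinate of the difference has value at most 1/p = pi^-e, and its weight is at most
    pi^(e-1). *)
Lemma ext_floor_dist x : w (x - floor x) < 1.
Proof.
rewrite {1}(basis_combK x) basis_combB; apply: (@le_lt_trans _ _ pi^-1); last first.
  by rewrite invf_lt1 // abs_beta_gt1.
apply: basis_comb_le => [|i j]; first by rewrite invr_ge0 ltW.
have [_ /(padic_abs_lt1 p_prime QpE)] :=
  padic_floorP p_prime QpE (coord (ext_basis e f gamma beta) (mxvec_index i j) x).
move=> /(ler_wpM2r (exprn_ge0 i (ltW pi_gt0)))/le_trans; apply.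
rewrite -abs_beta_expe ler_pdivrMl ?exprn_gt0 // ler_pdivlMr // -exprSr.
by apply: ler_weXn2l => //; exact: ltW abs_beta_gt1.
Qed.

(** The weights [pi ^+ i] are at least 1, so the coordinates are also at distance below 1 and
    [setX_digits_sep] applies to each. *)
Lemma setZ_sep x y : Z x -> Z y -> w (x - y) < 1 -> x = y.
Proof.
move=> [b [bX ->]] [c [cX ->]] xy; apply: eq_bigr => i _; apply: eq_bigr => j _.
congr (_ *: _); apply: (setX_digits_sep p_prime QpE) => //; apply: le_lt_trans xy.
rewrite -/(basis_comb b) -/(basis_comb c) basis_combB.
apply: le_trans (basis_comb_norm _ i j); rewrite ler_peMr ?(nabs_ge0 hv) //.
by rewrite exprn_ege1 // ltW // abs_beta_gt1.
Qed.

Lemma setZ_countable : countable Z.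
Proof.
pose h (nm : {ffun 'I_e * 'I_f -> nat * nat}) : K :=
  basis_comb (fun i j => (nm (i, j)).1%:R / p%:R ^+ (nm (i, j)).2).
apply: (@sub_countable _ _ _ (h @` setT)); last first.
  exact: (sub_countable (card_image_le _ _) (countableP _)).
apply: subset_card_le => z [b [bX ->]].
have /choice[nm nmP] : forall ij : 'I_e * 'I_f, exists nm : nat * nat,
    b ij.1 ij.2 = nm.1%:R / p%:R ^+ nm.2.
  move=> [i j]; have [k [n [_ bE]]] := setX_digitsE p_prime QpE (bX i j).
  by exists (n, k).
exists [ffun ij => nm ij] => //; apply: eq_bigr => i _; apply: eq_bigr => j _.
by rewrite ffunE -nmP.
Qed.

End Extension.

(** * Haar measure and the continued fraction map *)

Section ContinuedFraction.
Variables (R : realType) (F : fieldType) (w : F -> R) (beta : F).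
Variables (D : finType) (h : D -> F) (fl : F -> F) (Z : set F).
Variable lambda : {measure set (abs_borel w) -> \bar R}.
Hypotheses (hw : nonarch_abs w) (beta_gt1 : 1 < w beta).
Hypothesis w_value : forall x, x != 0 -> exists k : int, w x = w beta ^ k.
Hypothesis h_le1 : forall d, w (h d) <= 1.
Hypothesis h_inj : forall d d', w (h d - h d') < 1 -> d = d'.
Hypothesis h_onto : forall x, w x <= 1 -> exists d, w (x - h d) < 1.
Hypothesis fl_dist : forall x, w (x - fl x) < 1.
Hypothesis fl_in : forall x, Z (fl x).
Hypothesis Z_sep : forall x y, Z x -> Z y -> w (x - y) < 1 -> x = y.
Hypothesis Z_countable : countable Z.
Hypotheses (haar : haar_measure lambda) (lambda1 : lambda (unit_ball w) = 1%E).
Local Notation pi := (w beta).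
Local Notation q := (#|D|%:R : R).
Local Notation ball a k := (abs_ball w a (pi ^- k)).

Let pi_gt0 : 0 < pi. Proof. exact: lt_trans beta_gt1. Qed.
Let beta_neq0 : beta != 0. Proof. by rewrite -(nabs_gt0 hw). Qed.

Let wbV k : w (beta ^- k) = pi ^- k.
Proof. by rewrite (nabsV hw) (nabsX hw). Qed.

Lemma abs_ball_open a r : abs_open w (abs_ball w a r).
Proof.
move=> x xa; exists r; split => [|y yx]; last exact: (nabs_dist_lt hw yx xa).
by apply: le_lt_trans xa; rewrite (nabs_ge0 hw).
Qed.

Lemma measurable_abs_ball a r : measurable (abs_ball w a r : set (abs_borel w)).
Proof. by apply: sub_sigma_algebra; apply: abs_ball_open. Qed.

Lemma unit_ballE : unit_ball w = ball 0 0.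
Proof. by rewrite expr0 invr1. Qed.

Lemma unit_ballP x : unit_ball w x <-> w x < 1.
Proof. by rewrite /unit_ball /abs_ball /= subr0. Qed.

Lemma lambda_ball_center a r : lambda (abs_ball w a r) = lambda (abs_ball w 0 r).
Proof.
rewrite -(haar_translation haar a (measurable_abs_ball 0 r)); congr (lambda _).
apply/seteqP; split => [x xa|_ [y y0 <-]].
  by exists (x - a); [rewrite /abs_ball /= subr0|rewrite addrC subrK].
by move: y0; rewrite /abs_ball /= subr0 addrC addKr.
Qed.

(** Scaling by [beta ^+ k.+1] turns the ball into the elements of value below pi. By discreteness
    these are the elements of value at most 1, which fall into the classes of the [h d]. *)
Lemma ball_split k :
  ball 0 k = \bigcup_(d in [set: D]) ball (beta ^- k.+1 * h d) k.+1.
Proof.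
have bX0 : beta ^+ k.+1 != 0 by rewrite expf_neq0.
have piX0 : 0 < pi ^+ k.+1 by rewrite exprn_gt0.
apply/seteqP; split => [x|x [d _]]; rewrite /abs_ball /= subr0 => xk.
  have y1 : w (beta ^+ k.+1 * x) <= 1.
    have ypi : w (beta ^+ k.+1 * x) < pi.
      by rewrite (nabsM hw) (nabsX hw) exprS -mulrA gtr_pMr // mulrC -ltr_pdivlMr ?exprn_gt0 // div1r.
    have [->|y0] := eqVneq (beta ^+ k.+1 * x) 0; first by rewrite (nabs0 hw).
    have [j yj] := w_value y0; move: ypi; rewrite yj -{2}[pi]expr1z -(expr0z pi).
    by rewrite ltr_eXz2l // ler_eXz2l // ltzD1.
  have [d xd] := h_onto y1; exists d => //.
  rewrite /= -{1}(mulKf bX0 x) -mulrBr (nabsM hw) wbV.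
  by rewrite gtr_pMr // invr_gt0.
apply: (@le_lt_trans _ _ (pi ^- k.+1)); last first.
  by rewrite ltf_pV2 ?posrE ?exprn_gt0 // ltr_eXn2l.
rewrite -(subrK (beta ^- k.+1 * h d) x) (nabsD_le hw) //; first exact: ltW.
by rewrite (nabsM hw) wbV ler_piMr // invr_ge0 ltW.
Qed.

Lemma digits_gt0 : 0 < q.
Proof.
have [|d _] := h_onto (x := 0); first by rewrite (nabs0 hw).
by rewrite ltr0n; apply/card_gt0P; exists d.
Qed.

Lemma digits_gt1 : 1 < q.
Proof.
have [|d0 d0P] := h_onto (x := 0); first by rewrite (nabs0 hw).
have [|d1 d1P] := h_onto (x := 1); first by rewrite (nabs1 hw).
rewrite ltr1n; apply/card_gt1P; exists d0, d1; split => //.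
apply/eqP => d01; rewrite -d01 in d1P.
have := nabsB_lt hw d1P d0P; rewrite sub0r opprK subrK (nabs1 hw).
by rewrite ltxx.
Qed.

Lemma lambda_ball a k : lambda (ball a k) = (q ^- k)%:E.
Proof.
rewrite lambda_ball_center {a}; elim: k => [|k IH].
  by rewrite -unit_ballE lambda1 expr0 invr1.
have : lambda (ball 0 k) = (q%:E * lambda (ball 0 k.+1))%E.
  rewrite ball_split measure_fin_bigcup //.
  - rewrite (_ : [set: D] = [set` enum D]); last first.
      by apply/seteqP; split => // d _; rewrite /= mem_enum.
    rewrite -fsbig_seq ?enum_uniq //.
    rewrite (eq_bigr (fun=> lambda (ball 0 k.+1))) => [|d _]; last first.
      exact: lambda_ball_center.
    rewrite big_const_seq count_predT -cardE; elim: #|D| => [|n /= ->].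
      by rewrite mul0e.
    rewrite -{1}[lambda _]mul1e -ge0_muleDl ?lee_fin // -EFinD.
    by rewrite -[in RHS]natr1 addrC.
  - exact: finite_finset.
  - move=> d d' _ _ [x [xd xd']]; apply: h_inj.
    have : w (beta ^- k.+1 * h d - beta ^- k.+1 * h d') < pi ^- k.+1.
      by apply: (nabs_dist_lt hw) xd'; rewrite (nabs_distC hw).
    by rewrite -mulrBr (nabsM hw) wbV gtr_pMr // invr_gt0 exprn_gt0.
  - by move=> d _; apply: measurable_abs_ball.
rewrite IH => qk.
(* Division by q through associativity in the extended reals, before the measure is known to be
   finite. *)
have -> : lambda (ball 0 k.+1) = (q^-1%:E * (q%:E * lambda (ball 0 k.+1)))%E.
  by rewrite muleA -EFinM mulVf ?mul1e // gt_eqF // digits_gt0.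
by rewrite -qk -EFinM exprS invfM.
Qed.

Lemma measurable_zero : measurable ([set (0%R : F)] : set (abs_borel w)).
Proof.
rewrite -(setCK [set 0]); apply: measurableC; apply: sub_sigma_algebra => x /eqP x0.
exists (w x); split => [|y yx y0]; first by rewrite (nabs_gt0 hw).
by move: yx; rewrite /abs_ball /= y0 sub0r (nabsN hw) ltxx.
Qed.

Lemma lambda_zero : lambda [set (0%R : F)] = 0%E.
Proof.
have m0 := measurable_zero.
have le0 k : (lambda [set (0%R : F)] <= (q ^- k)%:E)%E.
  rewrite -(lambda_ball 0 k); apply: le_measure; rewrite ?inE //.
    exact: measurable_abs_ball.
  by move=> _ ->; rewrite /abs_ball /= subrr (nabs0 hw) invr_gt0 exprn_gt0.
apply/eqP; rewrite eq_le measure_ge0 andbT.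
have fin0 : lambda [set (0%R : F)] \is a fin_num.
  by rewrite ge0_fin_numE // (le_lt_trans (le0 0)) // ltry.
rewrite -(fineK fin0) lee_fin.
have : (fun k : nat => q^-1 ^+ k) @ \oo --> (0 : R).
  by apply: cvg_expr; rewrite ger0_norm ?invr_ge0 ?(ltW digits_gt0) // invf_lt1 ?digits_gt0 // digits_gt1.
move=> q0; apply: (cvgr_to_ge q0).
by apply: nearW => k; rewrite exprVn -lee_fin fineK.
Qed.

(** When |z| > 1 and [A] lies in the unit ball, this is the image of [A] under x -> 1/(z + x). *)
Definition cf_cylinder (z : F) (A : set F) : set F := [set x | x != 0 /\ A (x^-1 - z)].

(* Large enough to contain the events below and stable under [cf_cylinder], this
   class makes it unnecessary to show that balls determine Borel measures. *)
Inductive ball_union : set F -> Prop :=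
| ball_union0 : ball_union set0
| ball_union_ball a k : w a < 1 -> ball_union (ball a k)
| ball_union_cup (G : nat -> set F) :
    (forall n, ball_union (G n)) -> trivIset setT G -> ball_union (\bigcup_n G n).

Lemma ball_union_measurable A : ball_union A -> measurable (A : set (abs_borel w)).
Proof.
elim=> [|a k _|G _ IH _]; first exact: measurable0.
  exact: measurable_abs_ball.
exact: bigcupT_measurable.
Qed.

Lemma ball_union_sub A x : ball_union A -> A x -> w x < 1.
Proof.
elim=> [//|a k a1|G _ IH _ [n _ /IH //]]; rewrite /abs_ball /= => xa.
rewrite -(subrK a x); apply: (nabsD_lt hw) => //; apply: (lt_le_trans xa).
by rewrite invf_le1 ?exprn_gt0 // exprn_ege1 // ltW.
Qed.

Lemma ball_union_unit : ball_union (unit_ball w).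
Proof. by rewrite unit_ballE; apply: ball_union_ball; rewrite (nabs0 hw). Qed.

(** With u = z + a, the identity x - 1/u = -(1/x - u)(x/u) does everything once |x| = 1/|z| is
    known, and membership in either set forces that value. *)
Lemma cf_cylinder_ball z a k t : w z = pi ^+ t -> 1 < w z -> w a < 1 ->
  cf_cylinder z (ball a k) = ball (z + a)^-1 (k + 2 * t).
Proof.
move=> zt z1 a1; pose u := z + a.
have wu : w u = w z by rewrite /u (nabsD_dom hw) //; apply: lt_trans z1.
have u0 : u != 0 by rewrite -(nabs_gt0 hw) wu (lt_trans _ z1).
have wz0 : 0 < w z by apply: lt_trans z1.
have rad : pi ^- (k + 2 * t) = pi ^- k / w z ^+ 2.
  by rewrite zt -exprM exprD invfM mulnC.
have pik : pi ^- k <= 1 by rewrite invf_le1 ?exprn_gt0 // exprn_ege1 // ltW.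
have distE x : x != 0 -> w x = (w z)^-1 -> w (x - u^-1) = w (x^-1 - u) / w z ^+ 2.
  move=> x0 wx; have -> : x - u^-1 = - ((x^-1 - u) * (x / u)) by field; rewrite x0 u0.
  by rewrite (nabsN hw) !(nabsM hw) (nabsV hw) wx wu expr2 invfM.
apply/seteqP; split => [x [x0]|x]; rewrite /cf_cylinder /abs_ball /=.
  rewrite -addrA -opprD -/u => xa.
  have wx : w x = (w z)^-1.
    have : w u = w x^-1.
      rewrite (nabs_near hw (x := u)) // wu (nabs_distC hw); apply: (lt_trans xa).
      exact: le_lt_trans pik z1.
    by rewrite wu (nabsV hw) => ->; rewrite invrK.
  by rewrite distE // rad ltr_pM2r // invr_gt0 exprn_gt0.
rewrite -/u rad => xu.
have wx : w x = (w z)^-1.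
  rewrite (nabs_near hw (x := u^-1)) (nabsV hw) wu // (nabs_distC hw).
  apply: (lt_trans xu); rewrite expr2 invfM mulrA gtr_pMl ?invr_gt0 //.
  by rewrite ltr_pdivrMr // mul1r (le_lt_trans pik).
have x0 : x != 0 by rewrite -(nabs_gt0 hw) wx invr_gt0.
split => //; move: xu; rewrite distE // ltr_pM2r ?invr_gt0 ?exprn_gt0 //.
by rewrite /u opprD addrA.
Qed.

Let cf_cylinder_cup z (G : nat -> set F) :
  cf_cylinder z (\bigcup_n G n) = \bigcup_n cf_cylinder z (G n).
Proof.
apply/seteqP; split => [x [x0 [n _ Gn]]|x [n _ [x0 Gn]]]; first by exists n.
by split => //; exists n.
Qed.

Let cf_cylinder_triv z (G : nat -> set F) :
  trivIset setT G -> trivIset setT (fun n => cf_cylinder z (G n)).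
Proof.
move=> tG i j _ _ [x [[_ Gi] [_ Gj]]]; apply: tG => //.
by exists (x^-1 - z).
Qed.

Lemma value_nat z : 1 < w z -> exists t : nat, w z = pi ^+ t.
Proof.
move=> z1; have z0 : z != 0 by rewrite -(nabs_gt0 hw) (lt_trans _ z1).
have [k zk] := w_value z0; move: z1; rewrite zk -(expr0z pi) ltr_eXz2l // => k0.
by exists `|k|%N; rewrite exprnP gez0_abs // ltW.
Qed.

Lemma ball_union_cylinder z A : 1 < w z -> ball_union A -> ball_union (cf_cylinder z A).
Proof.
move=> z1; have [t zt] := value_nat z1.
elim=> [|a k a1|G GP IH tG].
- by rewrite (_ : cf_cylinder z set0 = set0); [exact: ball_union0|apply/seteqP; split => x // []].
- rewrite (cf_cylinder_ball k zt) //; apply: ball_union_ball.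
  have wza : w (z + a) = w z by rewrite (nabsD_dom hw) //; apply: lt_trans z1.
  by rewrite (nabsV hw) wza invf_lt1 // (lt_trans _ z1).
- by rewrite cf_cylinder_cup; apply: ball_union_cup => //; apply: cf_cylinder_triv.
Qed.

Lemma lambda_cylinder z t A : 1 < w z -> w z = pi ^+ t -> ball_union A ->
  lambda (cf_cylinder z A) = ((q ^- (2 * t))%:E * lambda A)%E.
Proof.
move=> z1 zt; elim=> [|a k a1|G GP IH tG].
- rewrite (_ : cf_cylinder z set0 = set0); last by apply/seteqP; split => x // [].
  by rewrite measure0 mule0.
- by rewrite (cf_cylinder_ball k zt) // !lambda_ball -EFinM exprD invfM mulrC.
- rewrite cf_cylinder_cup measure_semi_bigcup.
  + rewrite measure_semi_bigcup //.
    * by rewrite -nneseriesZl //; apply: eq_eseriesr => n _; apply: IH.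
    * by move=> n; apply: ball_union_measurable.
    * by apply: ball_union_measurable; apply: ball_union_cup.
  + by move=> n; apply: ball_union_measurable; apply: ball_union_cylinder.
  + exact: cf_cylinder_triv.
  + rewrite -cf_cylinder_cup; apply: ball_union_measurable.
    by apply: ball_union_cylinder => //; apply: ball_union_cup.
Qed.

(** * Preimages under the continued fraction map *)

Definition cf_step (x : F) : F := if x == 0 then 0 else x^-1 - fl x^-1.

(** The point 0 is left out so that the preimage is exactly a disjoint union of cylinders; it has
    measure zero. *)
Definition cf_preimage (A : set F) : set F :=
  [set x | [/\ w x < 1, x != 0 & A (cf_step x)]].

Lemma cf_step_lt1 x : w (cf_step x) < 1.
Proof. by rewrite /cf_step; case: ifP => _; rewrite ?(nabs0 hw) ?fl_dist. Qed.

Lemma floorE x z : Z z -> w (x - z) < 1 -> fl x = z.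
Proof.
move=> Zz xz; apply: Z_sep => //; apply: (nabs_dist_lt hw) xz.
by rewrite (nabs_distC hw) fl_dist.
Qed.

Lemma inv_lt1 x z : 1 < w z -> x != 0 -> w (x^-1 - z) < 1 -> w x < 1.
Proof.
move=> z1 x0 xz; have : w x^-1 = w z.
  by rewrite (nabs_near hw (x := z)) // (nabs_distC hw); apply: lt_trans z1.
rewrite (nabsV hw) => wx; rewrite -[w x]invrK wx invf_lt1 //.
exact: lt_trans z1.
Qed.

(** On the cylinder of [z] the map is x -> 1/x - z. Together with [lambda_cylinder] this makes the
    first partial quotient independent of what follows. *)
Lemma cylinder_preimage z A : Z z -> 1 < w z -> ball_union A ->
  cf_cylinder z (unit_ball w) `&` cf_preimage A = cf_cylinder z A.
Proof.
move=> Zz z1 bA; apply/seteqP; split => x.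
  move=> [[x0 /unit_ballP xz] [_ _]]; rewrite /cf_step (negPf x0) (floorE Zz xz).
  by split.
move=> [x0 Ax]; have xz := ball_union_sub bA Ax.
split; split => //; first exact/unit_ballP.
  exact: inv_lt1 xz.
by rewrite /cf_step (negPf x0) (floorE Zz xz).
Qed.

Section Preimage.
Variable code : F -> nat.
Hypothesis code_inj : {in Z &, injective code}.

(** Cylinders renumbered by naturals, as countable additivity is about sequences; a number that
    codes no suitable [z] gives the empty set. *)
Definition branch (A : set F) (n : nat) : set F :=
  \bigcup_(z in [set z | [/\ Z z, 1 < w z & code z = n]]) cf_cylinder z A.

Lemma branchP n : (exists z, [/\ Z z, 1 < w z & forall A, branch A n = cf_cylinder z A])
  \/ forall A, branch A n = set0.
Proof.
have [[z [Zz z1 zn]]|nz] := pselect (exists z, [/\ Z z, 1 < w z & code z = n]).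
  left; exists z; split => // A; apply/seteqP; split => [x [z' [Zz' _ zn']]|x xz].
    by have -> : z' = z by apply: code_inj; rewrite ?inE // zn.
  by exists z.
by right=> A; rewrite -subset0 => x [z zP _]; apply: nz; exists z.
Qed.

Lemma preimage_branch A : ball_union A -> cf_preimage A = \bigcup_n branch A n.
Proof.
move=> bA; apply/seteqP; split => [x [x1 x0 Ax]|x [n _ [z [Zz z1 zn] xz]]].
  exists (code (fl x^-1)) => //; exists (fl x^-1); last first.
    by split => //; move: Ax; rewrite /cf_step (negPf x0).
  split => //; rewrite (nabs_near hw (x := x^-1)).
    by rewrite (nabsV hw) invf_gt1 // (nabs_gt0 hw).
  apply: (lt_trans (fl_dist _)).
  by rewrite (nabsV hw) invf_gt1 // (nabs_gt0 hw).
by move: xz; rewrite -cylinder_preimage // => -[].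
Qed.

Lemma branch_triv A : ball_union A -> trivIset setT (branch A).
Proof.
move=> bA i j _ _ [x [[z [Zz _ <-] [_ xz]] [z' [Zz' _ <-] [_ xz']]]].
congr code; rewrite -(floorE Zz (ball_union_sub bA xz)).
exact: floorE (ball_union_sub bA xz').
Qed.

Lemma ball_union_branch A n : ball_union A -> ball_union (branch A n).
Proof.
move=> bA; have [[z [_ z1 ->]]|->] := branchP n; first exact: ball_union_cylinder.
exact: ball_union0.
Qed.

(** The factor is kept as the measure of a branch of the unit ball: these factors then add up to the
    measure of the preimage of the unit ball, which is 1, with no series to evaluate. *)
Lemma lambda_branch A n : ball_union A ->
  lambda (branch A n) = (lambda (branch (unit_ball w) n) * lambda A)%E.
Proof.
move=> bA; have [[z [_ z1 E]]|E] := branchP n; last by rewrite !E measure0 mul0e.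
have [t zt] := value_nat z1.
rewrite !E (lambda_cylinder z1 zt) // (lambda_cylinder z1 zt ball_union_unit).
by rewrite lambda1 mule1.
Qed.

Lemma ball_union_preimage_code A : ball_union A -> ball_union (cf_preimage A).
Proof.
move=> bA; rewrite preimage_branch //; apply: ball_union_cup; last exact: branch_triv.
by move=> n; apply: ball_union_branch.
Qed.

Lemma lambda_preimage_unit_code : lambda (cf_preimage (unit_ball w)) = 1%E.
Proof.
have m0 := measurable_zero.
rewrite -lambda1 -[LHS]adde0 -lambda_zero -measureU //.
- congr (lambda _); apply/seteqP; split => [x [[x1 _ _]|->]|x /unit_ballP x1].
  + exact/unit_ballP.
  + by apply/unit_ballP; rewrite (nabs0 hw).
  + have [->|x0] := eqVneq x 0; [by right|left; split => //].
    by apply/unit_ballP/cf_step_lt1.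
- exact: (ball_union_measurable (ball_union_preimage_code ball_union_unit)).
- by rewrite -subset0 => x [[_ /eqP x0 _]].
Qed.

Lemma lambda_preimage_code A : ball_union A -> lambda (cf_preimage A) = lambda A.
Proof.
move=> bA.
have finA : lambda A \is a fin_num.
  rewrite ge0_fin_numE ?measure_ge0 //; apply: (@le_lt_trans _ _ 1%E); last exact: ltry.
  rewrite -lambda1; apply: le_measure; rewrite ?inE.
  - exact: ball_union_measurable.
  - exact: (ball_union_measurable ball_union_unit).
  - by move=> x /(ball_union_sub bA) x1; apply/unit_ballP.
have sumE B : ball_union B -> lambda (cf_preimage B) = (\sum_(n <oo) lambda (branch B n))%E.
  move=> bB; rewrite preimage_branch // measure_semi_bigcup //.
  - by move=> n; apply: ball_union_measurable; apply: ball_union_branch.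
  - exact: branch_triv.
  - by apply: ball_union_measurable; rewrite -preimage_branch //; apply: ball_union_preimage_code.
rewrite sumE //; under eq_eseriesr do rewrite lambda_branch // muleC.
rewrite -(fineK finA) nneseriesZl // -sumE; last exact: ball_union_unit.
by rewrite lambda_preimage_unit_code mule1.
Qed.

End Preimage.

Let codeP : exists code : F -> nat, {in Z &, injective code}.
Proof. exact/countable_injP. Qed.

Lemma ball_union_preimage A : ball_union A -> ball_union (cf_preimage A).
Proof. by have [code code_inj] := codeP; apply: (ball_union_preimage_code code_inj). Qed.

Lemma lambda_preimage A : ball_union A -> lambda (cf_preimage A) = lambda A.
Proof. by have [code code_inj] := codeP; apply: (lambda_preimage_code code_inj). Qed.

(** [n] counts iterations of the map, so this is the event c_(n+1) = z. *)
Definition cf_event (z : F) (n : nat) : set F :=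
  iter n cf_preimage (cf_cylinder z (unit_ball w)).

Lemma cf_eventP z n x : Z z -> 1 < w z ->
  cf_event z n x <-> [/\ w x < 1, iter n cf_step x != 0 & fl (iter n cf_step x)^-1 = z].
Proof.
move=> Zz z1; elim: n x => [|n IH] x.
  split=> [[x0 /unit_ballP xz]|[x1 x0 <-]].
    by split => //; [exact: inv_lt1 xz|exact: floorE].
  by split => //; apply/unit_ballP/fl_dist.
(* Since 0 is fixed, a nonzero iterate forces a nonzero starting point, as [cf_preimage] demands. *)
have step0 : iter n cf_step 0 = 0.
  by elim: (n) => //= k ->; rewrite /cf_step eqxx.
rewrite iterSr /cf_event iterS -/(cf_event z n); split.
  by move=> [x1 x0 /IH [_ ? ?]].
move=> [x1 sx0 flx]; split => //; last by apply/IH; split => //; apply: cf_step_lt1.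
by apply: contraNneq sx0 => ->; rewrite {2}/cf_step eqxx step0.
Qed.

Lemma ball_union_event z n : 1 < w z -> ball_union (cf_event z n).
Proof.
move=> z1; elim: n => [|n IH]; last exact: ball_union_preimage.
by apply: ball_union_cylinder => //; exact: ball_union_unit.
Qed.

Lemma lambda_event z t n : 1 < w z -> w z = pi ^+ t ->
  lambda (cf_event z n) = (q ^- (2 * t))%:E.
Proof.
move=> z1 zt; elim: n => [|n IH].
  by rewrite (lambda_cylinder z1 zt ball_union_unit) lambda1 mule1.
by rewrite lambda_preimage ?IH //; apply: ball_union_event.
Qed.

(** For j = i + k + 1 the intersection is the i-th iterated preimage of the cylinder of [z] over
    event k. Invariance removes the preimages, and the cylinder contributes one factor. *)
Lemma lambda_eventI z t i j : Z z -> 1 < w z -> w z = pi ^+ t -> i != j ->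
  lambda (cf_event z i `&` cf_event z j) = ((q ^- (2 * t)) ^+ 2)%:E.
Proof.
move=> Zz z1 zt; wlog ij : i j / (i < j)%N.
  move=> wl ij; have [/wl|ji|e] := ltngtP i j; first exact.
    by rewrite setIC; apply: wl => //; rewrite eq_sym.
  by move: ij; rewrite e eqxx.
move=> _; have [k ->] : exists k, j = (i + k.+1)%N.
  by exists (j - i.+1)%N; rewrite -addSnnS subnKC.
have bE0 : cf_cylinder z (unit_ball w) `&` cf_preimage (cf_event z k) =
    cf_cylinder z (cf_event z k).
  by apply: cylinder_preimage => //; apply: ball_union_event.
have evI n : cf_event z n `&` cf_event z (n + k.+1) =
    iter n cf_preimage (cf_cylinder z (cf_event z k)).
  elim: n => [|n IH]; first by rewrite -bE0.
  rewrite addSn /cf_event !iterS -!/(cf_event z _) -IH.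
  apply/seteqP; split => x.
    by move=> [[x1 x0 Ax] [_ _ Bx]].
  by move=> [x1 x0 [Ax Bx]].
rewrite evI.
have : ball_union (cf_cylinder z (cf_event z k)).
  by apply: ball_union_cylinder => //; apply: ball_union_event.
have : lambda (cf_cylinder z (cf_event z k)) = ((q ^- (2 * t)) ^+ 2)%:E.
  rewrite (lambda_cylinder z1 zt) ?(lambda_event k z1 zt) -?EFinM //.
  exact: ball_union_event.
move: (cf_cylinder z _) => A lA bA.
suff : ball_union (iter i cf_preimage A) /\ lambda (iter i cf_preimage A) = lambda A.
  by move=> [_ ->].
elim: i {ij} => [//|n [bn ln]] /=; split; first exact: ball_union_preimage.
by rewrite lambda_preimage.
Qed.

End ContinuedFraction.

(** * Strong law of large numbers for pairwise independent events *)

Section StrongLaw.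
Context d (T : measurableType d) (R : realType).
Variables (mu : {measure set T -> \bar R}) (A : nat -> set T) (r : R).
Hypothesis mu1 : mu setT = 1%E.
Hypothesis mA : forall i, measurable (A i).
Hypothesis muA : forall i, mu (A i) = r%:E.
Hypothesis muAI : forall i j, i != j -> mu (A i `&` A j) = (r ^+ 2)%:E.

Definition hits n x : R := \sum_(i < n) \1_(A i) x.

Definition square_dev n x : R := (hits n x / n%:R - r) ^+ 2.

Let r_ge0 : 0 <= r.
Proof. by rewrite -lee_fin -(muA 0). Qed.

Let r_le1 : r <= 1.
Proof. by rewrite -lee_fin -(muA 0) -mu1 le_measure // inE. Qed.

Lemma measurable_hits n : measurable_fun setT (hits n).
Proof. by apply: measurable_sum => i; apply: measurable_indic. Qed.

Lemma measurable_square_dev n : measurable_fun setT (square_dev n).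
Proof.
apply: measurable_funX; apply: measurable_funB => //.
by apply: measurable_funM => //; apply: measurable_hits.
Qed.

Lemma integral_hits n : (\int[mu]_x (hits n x)%:E = (r *+ n)%:E)%E.
Proof.
under eq_integral do rewrite -sumEFin.
rewrite ge0_integral_sum //; last first.
  by move=> i; apply/measurable_EFinP; apply: measurable_indic.
under eq_bigr do rewrite integral_indic // setIT muA.
by rewrite sumEFin sumr_const card_ord.
Qed.

Lemma hits_sqrE n x : hits n x ^+ 2 = \sum_(ij : 'I_n * 'I_n) \1_(A ij.1 `&` A ij.2) x.
Proof.
rewrite expr2 /hits big_distrlr pair_bigA /=; apply: eq_bigr => ij _.
by rewrite indicI.
Qed.

(** The n diagonal pairs contribute r each; pairwise independence gives r^2 for each of the
    others. *)
Lemma integral_hits_sqr n :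
  (\int[mu]_x (hits n x ^+ 2)%:E = (r *+ n + (r ^+ 2) *+ (n * n - n))%:E)%E.
Proof.
under eq_integral do rewrite hits_sqrE -sumEFin.
have mAI (ij : 'I_n * 'I_n) : measurable (A ij.1 `&` A ij.2) by apply: measurableI.
rewrite ge0_integral_sum //; last first.
  by move=> ij; apply/measurable_EFinP; apply: measurable_indic.
have ijE (ij : 'I_n * 'I_n) :
    (\int[mu]_x (\1_(A ij.1 `&` A ij.2) x)%:E = (if ij.1 == ij.2 then r else r ^+ 2)%:E)%E.
  rewrite integral_indic // setIT; case: eqVneq => [->|ij'].
    by rewrite setIid muA.
  exact: muAI.
under eq_bigr do rewrite ijE.
rewrite sumEFin -(pair_bigA _ (fun i j : 'I_n => if i == j then r else r ^+ 2)) /=.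
have rowE (i : 'I_n) : \sum_(j < n) (if i == j then r else r ^+ 2) = r + r ^+ 2 *+ n.-1.
  rewrite (bigD1 i) //= eqxx; congr (_ + _).
  under eq_bigr => j ji do rewrite eq_sym (negPf ji).
  by rewrite sumr_const cardC1 card_ord.
under eq_bigr do rewrite rowE.
rewrite sumr_const card_ord mulrnDl -mulrnA; congr (_ + _ *+ _)%:E.
by rewrite -subn1 mulnBl mul1n.
Qed.

(** The variance of a mean of pairwise independent events. The negative cross term of the square is
    moved to the other side, which leaves only integrals of nonnegative functions. *)
Lemma integral_square_dev n : (0 < n)%N ->
  (\int[mu]_x (square_dev n x)%:E = ((r - r ^+ 2) / n%:R)%:E)%E.
Proof.
move=> n0; have nR0 : n%:R != 0 :> R by rewrite pnatr_eq0 -lt0n.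
have nR : 0 < n%:R :> R by rewrite ltr0n.
have hits0 x : 0 <= hits n x by apply: sumr_ge0.
(* Both sides are sums of nonnegative functions. *)
have devE x : ((square_dev n x)%:E + (2 * r / n%:R)%:E * (hits n x)%:E =
    (n%:R ^- 2)%:E * (hits n x ^+ 2)%:E + (r ^+ 2)%:E)%E.
  by rewrite -!EFinM -!EFinD; congr EFin; rewrite /square_dev; field.
have mH : measurable_fun setT (fun x => (hits n x)%:E).
  by apply/measurable_EFinP; apply: measurable_hits.
have mH2 : measurable_fun setT (fun x => (hits n x ^+ 2)%:E).
  by apply/measurable_EFinP; apply: measurable_funX; apply: measurable_hits.
have mD : measurable_fun setT (fun x => (square_dev n x)%:E).
  by apply/measurable_EFinP; apply: measurable_square_dev.
have c0 : 0 <= 2 * r / n%:R by rewrite divr_ge0 ?mulr_ge0 // ltW.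
have lhs : (\int[mu]_x ((square_dev n x)%:E + (2 * r / n%:R)%:E * (hits n x)%:E) =
    \int[mu]_x (square_dev n x)%:E + (2 * r / n%:R * (r *+ n))%:E)%E.
  rewrite ge0_integralD //.
  - rewrite ge0_integralZl_EFin // => [|x _]; last by rewrite lee_fin.
    by rewrite integral_hits.
  - by move=> x _; rewrite lee_fin; exact: sqr_ge0.
  - by move=> x _; rewrite -EFinM lee_fin mulr_ge0.
  - exact: measurable_funeM.
have rhs : (\int[mu]_x ((n%:R ^- 2)%:E * (hits n x ^+ 2)%:E + (r ^+ 2)%:E) =
    (n%:R ^- 2 * (r *+ n + (r ^+ 2) *+ (n * n - n)) + r ^+ 2)%:E)%E.
  have n20 : 0 <= n%:R ^- 2 :> R by rewrite invr_ge0 exprn_ge0 // ltW.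
  rewrite ge0_integralD //.
  - rewrite ge0_integralZl_EFin // => [|x _]; last by rewrite lee_fin sqr_ge0.
    by rewrite integral_hits_sqr integral_cst // mu1 mule1.
  - by move=> x _; rewrite -EFinM lee_fin mulr_ge0 // sqr_ge0.
  - exact: measurable_funeM.
  - by move=> x _; rewrite lee_fin sqr_ge0.
move: lhs; under eq_integral do rewrite devE.
rewrite rhs => /(congr1 (fun y => y - (2 * r / n%:R * (r *+ n))%:E)%E).
rewrite addeK // => <-; rewrite -EFinB; congr EFin.
have nn : (n <= n * n)%N by rewrite leq_pmull.
rewrite -[r *+ n]mulr_natr -[(r ^+ 2) *+ _]mulr_natr natrB // natrM.
by field.
Qed.

Lemma sum_inv_sqr_le n : \sum_(k < n) (k.+1%:R ^- 2 : R) <= 2.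
Proof.
case: n => [|n]; first by rewrite big_ord0.
(* The strengthening makes the induction telescope: 1/(m+1)^2 is at most 1/m - 1/(m+1). *)
suff : \sum_(k < n.+1) (k.+1%:R ^- 2 : R) <= 2 - n.+1%:R^-1.
  by move=> /le_trans; apply; rewrite gerBl invr_ge0.
elim: n => [|n IH]; first by rewrite big_ord1 expr1n invr1; lra.
rewrite big_ord_recr /=; apply: (le_trans (lerD IH (lexx _))).
have n0 : 0 < n.+1%:R :> R by rewrite ltr0n.
rewrite -[n.+2%:R]natr1; move: n0; set m : R := n.+1%:R => m0.
have m1 : 0 < m + 1 by apply: addr_gt0.
have -> : 2 - m^-1 + (m + 1) ^- 2 = 2 - (m + 1)^-1 - (m * (m + 1) ^+ 2)^-1.
  by field; rewrite !gt_eqF.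
by rewrite gerBl invr_ge0 mulr_ge0 ?exprn_ge0 // ltW.
Qed.

(** Integrating the series term by term gives at most 2, so it is finite almost everywhere and its
    terms tend to 0. The shift [k.+1] avoids the empty average. *)
Lemma ae_square_dev_cvg0 :
  {ae mu, forall x, square_dev (k.+1 ^ 2) x @[k --> \oo] --> (0 : R)}.
Proof.
pose G k x := (square_dev (k.+1 ^ 2) x)%:E.
have G0 k x : (0 <= G k x)%E by rewrite lee_fin; exact: sqr_ge0.
have mG k : measurable_fun setT (G k).
  by apply/measurable_EFinP; apply: measurable_square_dev.
have mS : measurable_fun setT (fun x => \sum_(k <oo) G k x)%E.
  by apply: ge0_emeasurable_sum => // k x _ _.
have intS : (\int[mu]_x (\sum_(k <oo) G k x) < +oo)%E.
  rewrite integral_nneseries //; apply: (@le_lt_trans _ _ 2%:E); last exact: ltry.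
  apply: lime_le; first by apply: is_cvg_nneseries => k _ _; apply: integral_ge0.
  apply: nearW => n; rewrite big_mkord.
  apply: (@le_trans _ _ (\sum_(k < n) (k.+1%:R ^- 2)%:E)%E); last first.
    by rewrite sumEFin lee_fin sum_inv_sqr_le.
  apply: lee_sum => k _; rewrite integral_square_dev ?expn_gt0 // lee_fin natrX.
  rewrite ler_piMl ?invr_ge0 ?exprn_ge0 //.
  by rewrite lerBlDr (le_trans r_le1) // lerDl sqr_ge0.
have iS : mu.-integrable setT (fun x => \sum_(k <oo) G k x)%E.
  apply/integrableP; split => //; apply: le_lt_trans intS; apply: ge0_le_integral => //.
  - exact: measurableT_comp.
  - by move=> x _; rewrite gee0_abs //; apply: nneseries_ge0.
apply: filterS (integrable_ae measurableT iS) => x /(_ I) Sfin.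
apply: (@cvg_series_cvg_0 R R^o); apply: nondecreasing_is_cvgn.
  by apply: nondecreasing_series => k _ _; apply: sqr_ge0.
exists (fine (\sum_(k <oo) G k x)%E) => _ [n _ <-].
rewrite -lee_fin fineK // /series /= -sumEFin.
exact: (@nneseries_lim_ge R (G^~ x) xpredT 0 n (fun k _ _ => G0 k x)).
Qed.

Lemma hits_diff m n x : (m <= n)%N -> 0 <= hits n x - hits m x <= (n - m)%:R.
Proof.
move=> mn; rewrite /hits -!(big_mkord xpredT (fun i => \1_(A i) x)).
rewrite (big_cat_nat (n := m)) //= addrAC subrr add0r sumr_ge0 //=.
apply: (@le_trans _ _ (\sum_(m <= i < n) 1)); last first.
  by rewrite big_const_nat iter_addr_0.
by apply: ler_sum => i _; rewrite indicE; case: (_ \in _).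
Qed.

Lemma hits_bounds n x : 0 <= hits n x <= n%:R.
Proof. by have := hits_diff x (leq0n n); rewrite /hits big_ord0 subr0 subn0. Qed.

Lemma hits_mean_diff m k x : (0 < k)%N -> (k ^ 2 <= m)%N -> (m < k.+1 ^ 2)%N ->
  `|hits m x / m%:R - hits (k ^ 2) x / (k ^ 2)%:R| <= 2 / k%:R.
Proof.
move=> k0 km mk; have /andP[d0 d1] := hits_diff x km.
have /andP[S0 S1] := hits_bounds (k ^ 2) x.
have mk2 : (m - k ^ 2)%:R <= 2 * k%:R :> R.
  rewrite -natrM ler_nat leq_subLR -ltnS; apply: (leq_trans mk).
  by rewrite -addn1 sqrnD !expnS expn0 !muln1; lia.
move: d1 mk2 S1; rewrite natrB // natrX.
have kR : 0 < k%:R :> R by rewrite ltr0n.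
have k2m : k%:R ^+ 2 <= m%:R :> R by rewrite -natrX ler_nat.
move: d0 S0 k2m kR; set S := hits (k ^ 2) x; set H := hits m x.
set M : R := m%:R; set c : R := k%:R => d0 S0 cM c0 d1 Mc S1.
have c2 : 0 < c ^+ 2 by rewrite exprn_gt0.
have M0 : 0 < M by apply: lt_le_trans cM.
(* Both terms on the right lie between 0 and (M - c^2)/M, which is at most 2/c because M - c^2 <= 2c
   and M >= c^2. *)
have -> : H / M - S / c ^+ 2 = (H - S) / M - S / c ^+ 2 * ((M - c ^+ 2) / M).
  by field; rewrite !gt_eqF.
have t0 : 0 <= (M - c ^+ 2) / M by rewrite divr_ge0 ?subr_ge0 // ltW.
have t2 : (M - c ^+ 2) / M <= 2 / c.
  rewrite ler_pdivrMr // mulrAC ler_pdivlMr //; apply: (@le_trans _ _ (2 * c * c)).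
    by rewrite ler_pM2r.
  by rewrite -mulrA -expr2 ler_pM2l.
have a0 : 0 <= (H - S) / M by rewrite divr_ge0 // ltW.
have a1 : (H - S) / M <= (M - c ^+ 2) / M by rewrite ler_pM2r // invr_gt0.
have u1 : S / c ^+ 2 <= 1 by rewrite ler_pdivrMr // mul1r.
have u0 : 0 <= S / c ^+ 2 by rewrite divr_ge0 // ltW.
have b1 : S / c ^+ 2 * ((M - c ^+ 2) / M) <= (M - c ^+ 2) / M by rewrite ler_piMl.
have b0 : 0 <= S / c ^+ 2 * ((M - c ^+ 2) / M) by rewrite mulr_ge0.
by rewrite ler_norml; apply/andP; split; lra.
Qed.

Lemma square_between n : exists k, (k ^ 2 <= n < k.+1 ^ 2)%N.
Proof.
elim: n => [|n [k /andP[kn nk]]]; first by exists 0.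
have [lt|ge] := ltnP n.+1 (k.+1 ^ 2); first by exists k; rewrite lt andbT ltnW.
exists k.+1; rewrite ge /=; apply: (leq_ltn_trans nk).
by rewrite ltn_exp2r.
Qed.

Theorem pairwise_strong_law :
  {ae mu, forall x, hits n x / n%:R @[n --> \oo] --> r}.
Proof.
apply: filterS ae_square_dev_cvg0 => x /cvgrPdist_lt dev0.
apply/cvgrPdist_lt => eps eps0; have eps2 : 0 < eps / 2 by rewrite divr_gt0.
have eps4 : 0 < eps / 4 by rewrite divr_gt0.
have [N1 _ N1P] := dev0 _ (exprn_gt0 2 eps2).
have [N2 _ N2P] := near_infty_natSinv_lt (PosNum eps4).
(* Beyond this square the root k exceeds [maxn N1 N2], so both estimates hold at index k - 1. The
   bound 1/k < eps/4 gives 2/k < eps/2 for the gap between squares, and the deviation at k^2 takes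
   the other half. *)
exists ((maxn N1 N2).+1 ^ 2)%N => // n Nn.
have [k /andP[kn nk]] := square_between n.
have Nk : (maxn N1 N2 < k)%N.
  by rewrite -ltnS -(@ltn_exp2r _ _ 2) //; apply: leq_ltn_trans Nn nk.
have k0 : (0 < k)%N by apply: leq_ltn_trans Nk.
have {}Nk : (maxn N1 N2 <= k.-1)%N by rewrite -ltnS prednK.
have := N1P _ (leq_trans (leq_maxl _ _) Nk).
have := N2P _ (leq_trans (leq_maxr _ _) Nk).
rewrite /= prednK // sub0r normrN ger0_norm ?sqr_ge0 // => kinv.
rewrite /square_dev -[X in X < _]real_normK ?num_real // ltr_pXn2r ?nnegrE ?normr_ge0 ?(ltW eps2) //.
move=> dev; have := hits_mean_diff x k0 kn nk; move: kinv dev.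
have -> : 2 / k%:R = 2 * k%:R^-1 :> R by [].
move: (k%:R^-1 : R) (hits n x / _) (hits (k ^ 2) x / _) => c u t ck rt ut.
move: ut rt; rewrite ltr_norml ler_norml ltr_norml => /andP[? ?] /andP[? ?].
by apply/andP; split; lra.
Qed.

End StrongLaw.

Theorem lemma22 (R : realType) (p e f : nat)
    (Qp : fieldType) (K : fieldExtType Qp) (v : Qp -> R) (w : K -> R)
    (L : {subfield K}) (gamma beta : K)
    (lambda : {measure set (abs_borel w) -> \bar R})
    (a : nat -> nat)
    (p_prime : prime p)
    (QpE : padic_field p v)
    (w_abs : nonarch_abs w)
    (w_ext : forall x : Qp, w x%:A = v x)
    (eE : ramification_index v w {:K}%AS e)
    (fE : residue_degree v w f)
    (L_degree : \dim L = f)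
    (L_unramified : ramification_index v w L 1)
    (gamma_root : (p ^ f - 1)%N.-primitive_root gamma)
    (L_gamma : <<1; gamma>>%VS = L :> {vspace K})
    (K_beta : <<L; beta>>%VS = fullv)
    (w_beta : w beta = p%:R `^ (e%:R^-1))
    (haar : haar_measure lambda)
    (lambda1 : lambda (unit_ball w) = 1%E)
    (a_good : L2_good_universal R a)
    (a_ud : forall theta : R, irrational theta ->
      uniformly_distributed_mod1 (fun n => (a n)%:R * theta)) :
  forall z : K, setZstar_digits p w e f gamma beta z ->
  {ae mrestr lambda (measurable_unit_ball w_abs), forall alpha : abs_borel w,
    unit_ball w alpha ->
    n%:R^-1 * (count
        (fun j => partial_quotient p v e f gamma beta (a j) alpha == Some z)
        (index_iota 1 n.+1))%:R
      @[n --> \oo] --> 1 / w z ^+ (2 * \dim {:K})}.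
Proof.
move=> z [Zz z1].
pose fl := ext_floor p v e f gamma beta.
have beta_gt1 := abs_beta_gt1 p_prime w_abs eE w_beta.
have w_value (x : K) : x != 0 -> exists k : int, w x = w beta ^ k.
  exact: ext_abs_value p_prime QpE w_abs eE w_beta x.
have h_le1 (d : {ffun 'I_f -> 'I_p}) : w (digit_comb (gammas gamma) d) <= 1.
  apply: (digit_comb_le1 p_prime QpE w_abs w_ext) => j.
  by rewrite (abs_gammaX w_abs gamma_root).
have h_inj := @digit_comb_inj _ _ _ _ _ _ _ _ p_prime QpE w_abs w_ext gamma_root.
have h_onto := @digit_comb_onto _ _ _ _ _ _ _ _ p_prime QpE w_abs w_ext fE gamma_root.
have fl_dist : forall x, w (x - fl x) < 1.
  exact: ext_floor_dist p_prime QpE w_abs w_ext eE fE gamma_root w_beta.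
have fl_in := ext_floor_in e f gamma beta p_prime QpE.
have Z_sep := @setZ_sep _ _ _ _ _ _ _ _ _ _ p_prime QpE w_abs w_ext eE gamma_root w_beta.
have Z_countable := setZ_countable e f gamma beta p_prime QpE.
have [t zt] := value_nat w_abs beta_gt1 w_value z1.
(* The cardinal is p^f = pi^(ef), and |z| = pi^t. *)
pose rho : R := (#|{ffun 'I_f -> 'I_p}|%:R) ^- (2 * t).
have rhoE : 1 / w z ^+ (2 * \dim {:K}) = rho.
  rewrite /rho card_ffun !card_ord natrX -(abs_beta_expe p_prime eE w_beta) zt.
  rewrite (ext_dim p_prime QpE w_abs w_ext eE fE gamma_root w_beta) div1r.
  by rewrite -!exprM; congr (_ ^- _); lia.
(* [hits] counts from 0 while the sequence starts at 1, whence [i.+1]; c_n is read off after n - 1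
   iterations, whence the subtraction. *)
pose A i := cf_event w fl z (a i.+1 - 1).
have bA i : ball_union w beta (A i).
  exact: (ball_union_event w_abs beta_gt1 w_value fl_dist fl_in Z_sep Z_countable (a i.+1 - 1) z1).
have A_sub i : A i `<=` unit_ball w.
  by move=> x /(ball_union_sub w_abs beta_gt1 (bA i)) x1; apply/unit_ballP.
have [[a_pos a_inc] _] := a_good.
have mA i : measurable (A i : set (abs_borel w)) by exact: (ball_union_measurable w_abs (bA i)).
have muE (B : set (abs_borel w)) : B `<=` unit_ball w ->
    mrestr lambda (measurable_unit_ball w_abs) B = lambda B.
  by move=> BU; rewrite /mrestr setIidl.
have mu1 : mrestr lambda (measurable_unit_ball w_abs) setT = 1%E.
  by rewrite /mrestr setTI.
have muA i : mrestr lambda (measurable_unit_ball w_abs) (A i) = rho%:E.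
  rewrite muE //; exact: (lambda_event w_abs beta_gt1 w_value h_le1 h_inj h_onto
    fl_dist fl_in Z_sep Z_countable haar lambda1 _ z1 zt).
have muAI i j : i != j ->
    mrestr lambda (measurable_unit_ball w_abs) (A i `&` A j) = (rho ^+ 2)%:E.
  move=> ij; rewrite muE; last by move=> x [/A_sub].
  apply: (lambda_eventI w_abs beta_gt1 w_value h_le1 h_inj h_onto
    fl_dist fl_in Z_sep Z_countable haar lambda1 Zz z1 zt).
  (* Distinct indices give distinct times: positivity of [a] keeps the natural subtraction from
     truncating. *)
  move: ij; apply: contra_neq => aij.
  have := a_inc i.+1 j.+1; have := a_inc j.+1 i.+1.
  have := a_pos i.+1; have := a_pos j.+1; lia.
apply: filterS (pairwise_strong_law mu1 mA muA muAI) => x lim_x xU.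
rewrite rhoE; apply: cvg_trans lim_x; apply: near_eq_cvg; apply: nearW => n.
rewrite [RHS]mulrC /hits; congr (_ * _); rewrite -sum1_count natr_sum.
rewrite [in RHS]big_mkcond big_add1 big_mkord; apply: eq_bigr => i _ /=.
have -> : (partial_quotient p v e f gamma beta (a i.+1) x == Some z) = (x \in A i).
  rewrite /partial_quotient -subn1 -[cf_map _ _ _ _ _ _]/(cf_step fl) -/fl.
  apply/eqP/idP; rewrite inE.
    case: ifP => // x0 [flz]; apply/(cf_eventP w_abs fl_dist fl_in Z_sep _ _ Zz z1).
    by split => //; [exact/unit_ballP|rewrite x0].
  by move/(cf_eventP w_abs fl_dist fl_in Z_sep _ _ Zz z1) => [_ /negPf -> ->].
by rewrite indicE; case: (_ \in _).
Qed.
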